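(* Let $X \subseteq \omega$ be non-computable and let $A \subseteq 2^\omega$ be a set with positive measure. Then $A$ has a perfect subset $C \subseteq A$ that does not compute $X$; that is, $X \not\leq_T P$, where $P = \{\sigma \in 2^{<\omega} : \sigma \text{ is an initial segment of some } Y \in C\}$.
   Context: Measure means the uniform (Lebesgue) measure on Cantor space $2^\omega$; a set with positive measure is a measurable set whose measure is strictly positive. A perfect set is a nonempty closed subset of $2^\omega$ without isolated points. A perfect set $C$ is identified, for purposes of computability, with the perfect tree $P$ of all initial segments of members of $C$. *)

(* Defs.v *)
From mathcomp Require Import all_boot all_order all_algebra.
From mathcomp Require Import all_classical all_reals all_analysis.

Set Implicit Arguments.
Unset Strict Implicit.
Unset Printing Implicit Defensive.

Import Order.TTheory GRing.Theory Num.Theory.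
Local Open Scope classical_set_scope.
Local Open Scope ring_scope.

(** * Relative computability: Kleene's mu-recursive functions with an oracle *)

(* [prog n] denotes programs for [n]-ary partial functions on nat. *)
Inductive prog : nat -> Type :=
  | Zero : prog 0
  | Succ : prog 1
  | Oracle : prog 1
  | Proj n : 'I_n -> prog n
  | Comp m n : prog m -> ('I_m -> prog n) -> prog n
  | Prim n : prog n -> prog n.+2 -> prog n.+1
  | Mu n : prog n.+1 -> prog n.

Fixpoint prim_rec (F : nat -> Prop) (G : nat -> nat -> nat -> Prop) (k z : nat) :
    Prop :=
  match k with
  | 0 => F z
  | k'.+1 => exists t, prim_rec F G k' t /\ G k' t z
  end.

(* [run O e v y]: the program [e], with oracle [O], halts on [v] with output
   [y].  Primitive recursion is on the first argument:
     h(0, v) = f(v),   h(k + 1, v) = g(k, h(k, v), v).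
   In [Mu], the value of [f] at every argument below [y] has to be defined
   and nonzero. *)
Fixpoint run (O : set nat) n (e : prog n) : n.-tuple nat -> nat -> Prop :=
  match e in prog n return n.-tuple nat -> nat -> Prop with
  | Zero => fun _ y => y = 0%N
  | Succ => fun v y => y = (thead v).+1
  | Oracle => fun v y => y = (thead v \in O)
  | Proj _ i => fun v y => y = tnth v i
  | Comp m _ f g => fun v y => exists w : m.-tuple nat,
      (forall i, run O (g i) v (tnth w i)) /\ run O f w y
  | Prim n f g => fun v y =>
      let u : n.-tuple nat := behead_tuple v in
      prim_rec (run O f u) (fun k t => run O g (cons_tuple k (cons_tuple t u)))
        (thead v) y
  | Mu _ f => fun v y =>
      run O f (cons_tuple y v) 0%N /\
      forall i, (i < y)%N -> exists t, run O f (cons_tuple i v) t.+1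
  end.

Fixpoint oracle_free n (e : prog n) : Prop :=
  match e with
  | Oracle => False
  | Comp _ _ f g => oracle_free f /\ forall i, oracle_free (g i)
  | Prim _ f g => oracle_free f /\ oracle_free g
  | Mu _ f => oracle_free f
  | _ => True
  end.

(* With oracle [O], [e] computes the characteristic function of [X]. *)
Definition decides (O : set nat) (e : prog 1) (X : set nat) : Prop :=
  forall n, run O e [tuple n] (n \in X).

(* The oracle passed to [decides] is irrelevant, as [e] never queries it. *)
Definition computable (X : set nat) : Prop :=
  exists e : prog 1, oracle_free e /\ decides set0 e X.

Definition turing_reducible (X Y : set nat) : Prop :=
  exists e : prog 1, decides Y e X.

Notation "X '<=_T' Y" := (turing_reducible X Y) (at level 70, no associativity).

(* Bijection between binary strings and nat: [s] is sent to its position in the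
   length-lexicographic order (bijective base-2 numeration). *)
Definition string_code (s : seq bool) : nat :=
  foldl (fun n (b : bool) => n.*2 + b.+1)%N 0%N s.

Definition string_set_code (P : set (seq bool)) : set nat := string_code @` P.

(** * Cantor space *)

Definition initial_segment (s : seq bool) (Y : cantor_space) : Prop :=
  s = mkseq Y (size s).

Definition prefix_tree (C : set cantor_space) : set (seq bool) :=
  [set s | exists2 Y, C Y & initial_segment s Y].

Definition cylinder (s : seq bool) : set cantor_space :=
  [set Y | initial_segment s Y].

(* Outer measure induced by the uniform measure of cylinders, 2 ^ - |s|.
   Lebesgue measure is its restriction to the Caratheodory-measurable sets. *)
Definition uniform_outer (R : realType) (A : set cantor_space) : \bar R :=
  ereal_inf [set (\sum_(n <oo) (2 ^- size (s n))%:E)%E |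
               s in [set s : nat -> seq bool | A `<=` \bigcup_n cylinder (s n)]].

Definition has_positive_measure (R : realType) (A : set cantor_space) : Prop :=
  (@uniform_outer R).-caratheodory A /\ (0 < uniform_outer R A)%E.

(* [perfect_set] does not exclude the empty set. *)
Definition perfect_subset (C A : set cantor_space) : Prop :=
  [/\ C !=set0, perfect_set C & C `<=` A].

(* Main.v *)
Require Import Defs.
From mathcomp Require Import all_boot all_order all_algebra.
From mathcomp Require Import all_classical all_reals all_analysis.
From mathcomp Require Import zify ring lra.

(** The perfect set is the intersection of a sequence of stages, each defeating
one Turing functional.  A stage consists of finitely many strings on one level
and a tree [T] of positive measure above each of them; later stages extend the
strings inside the tree and shrink the tree.  The first tree comes from a cover
of the complement of [A] by cylinders of total measure less than 1: the strings
extending no string of the cover form a tree of positive measure, all of whose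
branches are in [A] ([positive_measure_tree]).

[A], and hence [T], may compute [X], so a functional must be defeated without
asking anything about [T].  By the Lebesgue density theorem, the strings of the
stage can be extended so that [T] has relative measure at least 3/4 above each
([fat_zoom]).  For an input [n] and a value [b], the question asked is whether
every tree [G] of relative measure at least 1/2 above each string contains a
finite extension of the stage on which the program [e] outputs [b] on input [n]
([forced]).  By compactness a positive answer is witnessed at a finite depth,
so positive answers can be enumerated: the question mentions the finitely many
strings of the stage, but neither [T] nor [A].  There are three cases.
- For some [n] the answer is positive for the wrong value of [X] at [n].
  The nodes of [T] above which [T] has positive measure form a possible [G].
  It yields an extension of the stage, inside [T], on which [e] errs
  ([stage_force_wrong]).
- For some [n] the answer is negative for the correct value.  By compactness
  some tree [G] of relative measure at least 1/2 contains no extension on which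
  [e] is correct at [n].  As 3/4 + 1/2 > 1, the tree [T] can be replaced by its
  intersection with [G] ([stage_avoid]).
- Otherwise, for every [n] the answer is positive for exactly the correct
  value, and searching for a positive answer computes [X]
  ([computable_search]).

Since [X] is not computable, one of the first two cases holds for each program
([stage_force]).  Between two such steps every string is split in two
([stage_split]); this makes the intersection perfect ([fusion_perfect]), and
its tree of initial segments passes through all stages.

Enumerating positive answers requires a total evaluator of [e] with bounded
resources and a finite oracle, together with the computability of bounded
searches over finite sets of strings.

Strings are represented by positive integers: the empty string is 1, and the
children of [m] are [2 m] and [2 m + 1].  This integer exceeds [string_code] by
one, prefixes are the quotients by powers of 2, and [m] has length [a] when
[m %/ 2 ^ a = 1]. *)

Set Implicit Arguments.
Unset Strict Implicit.
Unset Printing Implicit Defensive.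
Import Order.TTheory GRing.Theory Num.Theory.
Local Open Scope nat_scope.

(** * Total recursive functions of a list of arguments *)

Definition recursive_at k (f : seq nat -> nat) : Prop :=
  exists e : prog k, oracle_free e /\ forall v : k.-tuple nat, run set0 e v (f v).

(** One function of a list is required to be computed at every arity.  Reading
missing arguments as 0 makes this possible, and it spares all arity side
conditions when variables are bound or dropped. *)
Definition recursive (f : seq nat -> nat) : Prop := forall k, recursive_at k f.

Definition decidable_pred (P : seq nat -> bool) : Prop := recursive (fun v => P v).

Lemma recursive_at_eq k (f g : seq nat -> nat) :
  (forall v : k.-tuple nat, f v = g v) -> recursive_at k f -> recursive_at k g.
Proof. by move=> fg [e [ofe re]]; exists e; split=> // v; rewrite -fg. Qed.

Lemma recursive_ext f g : f =1 g -> recursive f -> recursive g.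
Proof. by move=> fg rf k; apply: recursive_at_eq (rf k) => v; rewrite fg. Qed.

Lemma recursive_at_comp m k f (G : nat -> seq nat -> nat) :
  recursive_at m f -> (forall i, i < m -> recursive_at k (G i)) ->
  recursive_at k (fun v => f (mkseq (G^~ v) m)).
Proof.
move=> [ef [ofef ref]] rG.
have /fin_all_exists[eG eGP] : forall i : 'I_m, exists e : prog k,
  oracle_free e /\ forall v : k.-tuple nat, run set0 e v (G i v).
  by move=> i; apply: rG.
exists (Comp ef eG); split; first by split=> // i; case: (eGP i).
move=> v; exists [tuple G i v | i < m]; split.
  by move=> i; rewrite tnth_mktuple; apply: (eGP i).2.
rewrite (_ : mkseq _ m = [tuple G i v | i < m]); first exact: ref.
by rewrite /= /mkseq -val_enum_ord -map_comp.
Qed.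

Lemma recursive_at_proj k i : i < k -> recursive_at k (fun v => nth 0 v i).
Proof.
by move=> ik; exists (Proj (Ordinal ik)); split=> // v /=; rewrite (tnth_nth 0).
Qed.

(** The only constant of the language is nullary; composing it with an empty
family of programs raises its arity. *)
Lemma recursive_at_zero k : recursive_at k (fun=> 0).
Proof.
have [e [ofe re]] := @recursive_at_comp 0 k (fun=> 0) (fun _ _ => 0)
  (ex_intro _ Zero (conj I (fun=> erefl))) (fun i (i0 : i < 0) => ltac:(by [])).
by exists e.
Qed.

Lemma recursive_proj i : recursive (fun v => nth 0 v i).
Proof.
move=> k; case: (ltnP i k) => [|ki]; first exact: recursive_at_proj.
apply: recursive_at_eq (recursive_at_zero k) => v.
by rewrite nth_default // size_tuple.
Qed.

Lemma recursive_comp1 (F : nat -> nat) g :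
  recursive_at 1 (fun v => F (nth 0 v 0)) -> recursive g ->
  recursive (fun v => F (g v)).
Proof. by move=> rF rg k; apply: (recursive_at_comp (G := fun=> g) rF). Qed.

Lemma recursive_succ g : recursive g -> recursive (fun v => (g v).+1).
Proof.
apply: recursive_comp1; exists Succ; split=> // v.
by rewrite /= /thead (tnth_nth 0).
Qed.

Lemma recursive_const c : recursive (fun=> c).
Proof. by elim: c => [k|c /recursive_succ//]; apply: recursive_at_zero. Qed.

Lemma mkseq_cons (T : Type) (f : nat -> T) n :
  mkseq f n.+1 = f 0 :: mkseq (fun i => f i.+1) n.
Proof. by rewrite /mkseq (iotaD 0 1 n) map_cat /= (iotaDl 1 0) -map_comp. Qed.

Lemma recursive_cons f g j :
  recursive f -> recursive g -> recursive (fun v => f (g v :: drop j v)).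
Proof.
move=> rf rg k.
pose G i := if i is l.+1 then nth 0 ^~ (j + l) else g.
apply: recursive_at_eq (recursive_at_comp (G := G) (rf (k - j).+1) _).
  move=> v; congr f; rewrite mkseq_cons; congr cons.
  rewrite -[RHS](mkseq_nth 0) size_drop size_tuple.
  by apply: eq_map => i /=; rewrite nth_drop.
by move=> [|i] _; [exact: rg | exact: recursive_proj].
Qed.

Lemma recursive_behead f : recursive f -> recursive (fun v => f (behead v)).
Proof.
move=> rf k.
apply: recursive_at_eq
  (recursive_at_comp (G := fun i => nth 0 ^~ i.+1) (rf k.-1) _).
  move=> v; congr f; rewrite -[RHS](mkseq_nth 0) size_behead size_tuple.
  by apply: eq_map => i /=; rewrite nth_behead.
by move=> i _; apply: recursive_proj.
Qed.

(** The whole context serves as the parameters of a primitive recursion. *)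
Lemma recursive_nat_rect b (st : nat -> nat -> seq nat -> nat) n :
  recursive b -> recursive n ->
  recursive (fun w => st (nth 0 w 0) (nth 0 w 1) (behead (behead w))) ->
  recursive (fun v => nat_rect (fun=> nat) (b v) (fun i t => st i t v) (n v)).
Proof.
move=> rb rn rst k.
have [[eb [ofb rb']] [es [ofs rs]]] := (rb k, rst k.+2).
have rP : recursive_at k.+1
  (fun w => nat_rect (fun=> nat) (b (behead w)) (fun i t => st i t (behead w))
                     (nth 0 w 0)).
  exists (Prim eb es); split=> //= v.
  rewrite {1}/thead (tnth_nth 0) /=.
  elim: (nth 0 v 0) => [|i IHi] /=.
    by have := rb' (behead_tuple v).
  eexists; split; first exact: IHi.
  by have := rs (cons_tuple i (cons_tuple _ (behead_tuple v))); apply.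
pose G i := if i is j.+1 then nth 0 ^~ j else n.
apply: recursive_at_eq (recursive_at_comp (G := G) rP _) => [v|[|i] _].
- have vE : mkseq (nth 0 v) k = v by rewrite -[RHS](mkseq_nth 0) size_tuple.
  by rewrite mkseq_cons /= vE.
- exact: rn.
- exact: recursive_proj.
Qed.

Lemma recursive_add f g :
  recursive f -> recursive g -> recursive (fun v => f v + g v).
Proof.
move=> rf rg.
have := recursive_nat_rect (st := fun _ t _ => t.+1) rf rg
          (recursive_succ (@recursive_proj 1)).
by apply: recursive_ext => v; elim: (g v) => [|n /= ->]; rewrite ?addn0 ?addnS.
Qed.

Lemma recursive_mul f g :
  recursive f -> recursive g -> recursive (fun v => f v * g v).
Proof.
move=> rf rg.
have := recursive_nat_rect (st := fun _ t w => f w + t) (@recursive_const 0) rg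
  (recursive_add (recursive_behead (recursive_behead rf)) (@recursive_proj 1)).
by apply: recursive_ext => v; elim: (g v) => [|n /= ->]; rewrite ?muln0 ?mulnS.
Qed.

Lemma recursive_exp f g :
  recursive f -> recursive g -> recursive (fun v => f v ^ g v).
Proof.
move=> rf rg.
have := recursive_nat_rect (st := fun _ t w => f w * t) (@recursive_const 1) rg
  (recursive_mul (recursive_behead (recursive_behead rf)) (@recursive_proj 1)).
by apply: recursive_ext => v; elim: (g v) => [|n /= ->]; rewrite ?expn0 ?expnS.
Qed.

Lemma recursive_pred f : recursive f -> recursive (fun v => (f v).-1).
Proof.
move=> rf.
have := recursive_nat_rect (st := fun i _ _ => i) (@recursive_const 0) rf
  (@recursive_proj 0).
by apply: recursive_ext => v; case: (f v).
Qed.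

Lemma recursive_sub f g :
  recursive f -> recursive g -> recursive (fun v => f v - g v).
Proof.
move=> rf rg.
have := recursive_nat_rect (st := fun _ t _ => t.-1) rf rg
          (recursive_pred (@recursive_proj 1)).
by apply: recursive_ext => v; elim: (g v) => [|n /= ->]; rewrite ?subn0 ?subnS.
Qed.

Lemma decidable_neg P : decidable_pred P -> decidable_pred (fun v => ~~ P v).
Proof.
move=> /(recursive_sub (@recursive_const 1)).
by apply: recursive_ext => v; case: (P v).
Qed.

Lemma decidable_eq0 f : recursive f -> decidable_pred (fun v => f v == 0).
Proof.
by move=> /(recursive_sub (@recursive_const 1)); apply: recursive_ext => v; case: (f v).
Qed.

Lemma decidable_leq f g :
  recursive f -> recursive g -> decidable_pred (fun v => f v <= g v).
Proof. by move=> rf rg; apply/decidable_eq0/recursive_sub. Qed.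

Lemma decidable_and P Q :
  decidable_pred P -> decidable_pred Q -> decidable_pred (fun v => P v && Q v).
Proof.
move=> dP dQ; apply: recursive_ext (recursive_mul dP dQ) => v.
by case: (P v); case: (Q v).
Qed.

Lemma decidable_or P Q :
  decidable_pred P -> decidable_pred Q -> decidable_pred (fun v => P v || Q v).
Proof.
move=> dP dQ.
have := decidable_neg (decidable_and (decidable_neg dP) (decidable_neg dQ)).
by apply: recursive_ext => v; case: (P v); case: (Q v).
Qed.

Lemma decidable_imply P Q :
  decidable_pred P -> decidable_pred Q -> decidable_pred (fun v => P v ==> Q v).
Proof.
move=> dP dQ; apply: recursive_ext (decidable_or (decidable_neg dP) dQ) => v.
by rewrite implybE.
Qed.

Lemma decidable_eqn f g :
  recursive f -> recursive g -> decidable_pred (fun v => f v == g v).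
Proof.
move=> rf rg.
have := decidable_and (decidable_leq rf rg) (decidable_leq rg rf).
by apply: recursive_ext => v; rewrite eqn_leq.
Qed.

Lemma recursive_if P f g : decidable_pred P -> recursive f -> recursive g ->
  recursive (fun v => if P v then f v else g v).
Proof.
move=> dP rf rg.
have := recursive_add (recursive_mul dP rf) (recursive_mul (decidable_neg dP) rg).
by apply: recursive_ext => v; case: (P v) => /=; rewrite ?mul1n ?mul0n ?addn0.
Qed.

Lemma recursive_sum n (F : nat -> seq nat -> nat) :
  recursive n -> recursive (fun w => F (nth 0 w 0) (behead w)) ->
  recursive (fun v => \sum_(0 <= i < n v) F i v).
Proof.
move=> rn rF.
have rF' : recursive (fun w => nth 0 w 1 + F (nth 0 w 0) (behead (behead w))).
  apply: recursive_add; first exact: recursive_proj.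
  apply: recursive_ext (recursive_cons 2 rF (@recursive_proj 0)) => w /=.
  by case: w => [|a [|b w]] //=; rewrite drop0.
have := recursive_nat_rect (st := fun i t w => t + F i w) (@recursive_const 0) rn rF'.
apply: recursive_ext => v; elim: (n v) => [|m /= ->]; first by rewrite big_geq.
by rewrite big_nat_recr.
Qed.

(** Bounded quantifiers.  The bound variable is pushed in front of the context,
so [behead] of the list is the outer context. *)
Lemma decidable_has n (P : nat -> seq nat -> bool) :
  recursive n -> decidable_pred (fun w => P (nth 0 w 0) (behead w)) ->
  decidable_pred (fun v => has (P^~ v) (iota 0 (n v))).
Proof.
move=> rn dP.
have rS := recursive_sum (F := fun i v => P i v) rn dP.
have := decidable_neg (decidable_eq0 rS).
apply: recursive_ext => v /=; congr nat_of_bool.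
rewrite /index_iota subn0 sum_nat_seq_eq0 -has_predC /=.
by apply: eq_has => i /=; case: (P i v).
Qed.

Lemma decidable_all n (P : nat -> seq nat -> bool) :
  recursive n -> decidable_pred (fun w => P (nth 0 w 0) (behead w)) ->
  decidable_pred (fun v => all (P^~ v) (iota 0 (n v))).
Proof.
move=> rn /decidable_neg dP.
have := decidable_neg (decidable_has (P := fun i v => ~~ P i v) rn dP).
by apply: recursive_ext => v; rewrite has_predC negbK.
Qed.

(** The quotient is the number of [i < f v] such that [(i + 1) 2 ^ g v <= f v]. *)
Lemma recursive_divn_exp2 f g :
  recursive f -> recursive g -> recursive (fun v => f v %/ 2 ^ g v).
Proof.
move=> rf rg.
have rF : recursive (fun w => nth 0 w 0 < f (behead w) %/ 2 ^ g (behead w)).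
  have rf' := recursive_behead rf; have rg' := recursive_behead rg.
  have := decidable_leq (recursive_mul (recursive_succ (@recursive_proj 0))
    (recursive_exp (@recursive_const 2) rg')) rf'.
  by apply: recursive_ext => w; rewrite -leq_divRL ?expn_gt0.
have := recursive_sum (F := fun i v => i < f v %/ 2 ^ g v) rf rF.
apply: recursive_ext => v.
have sum_lt q m : \sum_(0 <= i < m) (i < q : nat) = minn m q.
  elim: m => [|m IHm]; first by rewrite big_geq ?min0n.
  by rewrite big_nat_recr //= IHm; case: (ltnP m q) => ?; lia.
by rewrite sum_lt; apply/minn_idPr/leq_div.
Qed.

Lemma decidable_odd f : recursive f -> decidable_pred (fun v => odd (f v)).
Proof.
move=> rf.
have := recursive_nat_rect (st := fun _ t _ => 1 - t) (@recursive_const 0) rf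
  (recursive_sub (@recursive_const 1) (@recursive_proj 1)).
by apply: recursive_ext => v; elim: (f v) => //= n ->; case: (odd n).
Qed.

Lemma decidable_mem (s : seq nat) f :
  recursive f -> decidable_pred (fun v => f v \in s).
Proof.
move=> rf; elim: s => [|a s IHs]; first exact: (@recursive_const 0).
have := decidable_or (decidable_eqn rf (@recursive_const a)) IHs.
by apply: recursive_ext => v; rewrite inE.
Qed.

Lemma recursive_subst (F : nat -> seq nat -> nat) g :
  recursive (fun w => F (nth 0 w 0) (behead w)) -> recursive g ->
  recursive (fun w => F (g w) w).
Proof.
move=> rF rg; apply: recursive_ext (recursive_cons 0 rF rg) => w /=.
by rewrite drop0.
Qed.

Lemma recursive_weaken (F : nat -> seq nat -> nat) :
  recursive (fun w => F (nth 0 w 0) (behead w)) ->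
  recursive (fun w => F (nth 0 w 0) (behead (behead w))).
Proof.
move=> rF; apply: recursive_ext (recursive_cons 2 rF (@recursive_proj 0)) => w.
by case: w => [|a [|b w]] //=; rewrite drop0.
Qed.

(** * Bounded evaluation of oracle programs *)

(** Minimization below [s] for a function whose value 0 means undefined and
whose value [y + 1] means [y].  At most one term of the sum is nonzero. *)
Definition mu_below (p : nat -> nat) s :=
  \sum_(0 <= y < s)
    (if (p y == 1) && all (fun i => 1 < p i) (iota 0 y) then y.+1 else 0).

Lemma mu_belowP p s y :
  mu_below p s = y.+1 <->
  [/\ y < s, p y = 1 & forall i, i < y -> 1 < p i].
Proof.
pose good z := (p z == 1) && all (fun i => 1 < p i) (iota 0 z).
have goodP z : good z <-> p z = 1 /\ forall i, i < z -> 1 < p i.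
  split=> [/andP[/eqP pz /allP pi]|[pz pi]].
    by split=> // i iz; apply: pi; rewrite mem_iota.
  rewrite /good pz eqxx; apply/allP => i; rewrite mem_iota => /andP[_]; exact: pi.
have good_inj z z' : good z -> good z' -> z = z'.
  move=> /goodP[pz pi] /goodP[pz' pi'].
  case: (ltngtP z z') => // zz'; first by have := pi' _ zz'; rewrite pz.
  by have := pi _ zz'; rewrite pz'.
have val z : z < s -> good z -> mu_below p s = z.+1.
  move=> zs gz; rewrite /mu_below (bigD1_seq z) ?iota_uniq ?mem_index_iota //=.
  rewrite -/(good z) gz big1 ?addn0 // => i iz; case: ifP => // gi.
  by rewrite (good_inj _ _ gi gz) eqxx in iz.
split=> [pE|[ys py pi]]; last by apply: val => //; apply/goodP.
have : mu_below p s != 0 by rewrite pE.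
rewrite /mu_below sum_nat_seq_neq0 => /hasP[z].
rewrite mem_index_iota /= => zs; case: ifP => // gz _.
have := val z zs gz; rewrite pE => -[->]; split=> //; by case/goodP: gz.
Qed.

(** The bound [s] limits both the oracle queries and the range of the
minimizations, which makes the evaluator total.  The result is 0 if the
resources do not suffice, and [y + 1] if the output is [y]. *)
Fixpoint eval_upto (O : nat -> bool) (s : nat) n (e : prog n) (v : seq nat) : nat :=
  match e with
  | Zero => 1
  | Succ => (nth 0 v 0).+2
  | Oracle => if nth 0 v 0 < s then (O (nth 0 v 0)).+1 else 0
  | Proj _ i => (nth 0 v i).+1
  | Comp m _ f g =>
      if all (fun i => eval_upto O s (g i) v != 0) (enum 'I_m)
      then eval_upto O s f [seq (eval_upto O s (g i) v).-1 | i <- enum 'I_m] else 0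
  | Prim _ f g =>
      nat_rect (fun=> nat) (eval_upto O s f (behead v))
        (fun i t => if t == 0 then 0 else eval_upto O s g (i :: t.-1 :: behead v))
        (nth 0 v 0)
  | Mu _ f => mu_below (fun y => eval_upto O s f (y :: v)) s
  end.

(** The use principle: a successful evaluation survives a larger bound and a
change of the oracle above the old bound. *)
Lemma eval_upto_monotone O O' s s' n (e : prog n) v y :
  s <= s' -> (forall c, c < s -> O c = O' c) ->
  eval_upto O s e v = y.+1 -> eval_upto O' s' e v = y.+1.
Proof.
move=> ss' OO'.
elim: e v y => //= [v y|m k f IHf g IHg v y|k f IHf g IHg v|k f IHf v y].
- by case: ifP => // cs; rewrite (leq_trans cs ss') OO'.
- case: ifP => // /allP gs /IHf evf.
  have gE i : eval_upto O' s' (g i) v = eval_upto O s (g i) v.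
    have : eval_upto O s (g i) v != 0 by apply: gs; rewrite mem_enum.
    by case: (eval_upto O s (g i) v) (IHg i v) => // z /(_ z erefl) ->.
  rewrite (_ : all _ _) ?(eq_map (fun i => congr1 predn (gE i))) //.
  by apply/allP => i iI; rewrite gE gs.
- elim: (nth 0 v 0) => [|i IHi] /= y; first exact: IHf.
  by case: (nat_rect _ _ _ _) IHi => //= t /(_ t erefl) -> /= /IHg.
- move=> /mu_belowP[ys fy fi]; apply/mu_belowP; split.
  + exact: leq_trans ss'.
  + exact: IHf.
  + by move=> i /fi; case: eval_upto (IHf (i :: v)) => // z /(_ z erefl) ->.
Qed.

Lemma eval_upto_sound O (Y : set nat) s n (e : prog n) (v : n.-tuple nat) y :
  (forall c, c < s -> O c = (c \in Y)) -> eval_upto O s e v = y.+1 -> run Y e v y.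
Proof.
move=> OY; elim: e v y => //= [v y [<-]|v y [<-]|v y|k i v y [<-]|
  m k f IHf g IHg v y|k f IHf g IHg v|k f IHf v y].
- by [].
- by rewrite /thead (tnth_nth 0).
- by rewrite /thead (tnth_nth 0); case: ifP => // cs [<-]; rewrite OY.
- by rewrite (tnth_nth 0).
- case: ifP => // /allP gs evf.
  exists [tuple (eval_upto O s (g i) v).-1 | i < m]; split; last exact: IHf.
  move=> i; rewrite tnth_mktuple; apply: IHg.
  by rewrite prednK // lt0n gs ?mem_enum.
- rewrite /thead (tnth_nth 0).
  elim: (nth 0 v 0) => [|i IHi] /= y; first exact: (IHf (behead_tuple v)).
  case: (nat_rect _ _ _ _) IHi => //= t /(_ t erefl) rt evg; exists t; split=> //.
  exact: (IHg (cons_tuple i (cons_tuple t (behead_tuple v)))).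
- move=> /mu_belowP[ys fy fi]; split; first exact: (IHf (cons_tuple y v)).
  move=> i /fi; case evf : (eval_upto O s f (i :: v)) => [//|[//|t]] _.
  by exists t; apply: (IHf (cons_tuple i v)).
Qed.

Lemma eval_upto_complete (Y : set nat) n (e : prog n) (v : n.-tuple nat) y :
  run Y e v y -> exists s, eval_upto (fun c => c \in Y) s e v = y.+1.
Proof.
have mono s s' k (f : prog k) w z : s <= s' ->
    eval_upto (fun c => c \in Y) s f w = z.+1 ->
    eval_upto (fun c => c \in Y) s' f w = z.+1.
  by move=> ss'; apply: eval_upto_monotone.
elim: e v y => /= [v y ->|v y ->|v y ->|k i v y ->|m k f IHf g IHg v y [w [gw fw]]|
  k f IHf g IHg v|k f IHf v y [fy fi]].
- by exists 0.
- by exists 0; rewrite /thead (tnth_nth 0).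
- by exists (thead v).+1; rewrite /thead (tnth_nth 0) ltnSn.
- by exists 0; rewrite (tnth_nth 0).
- have [sf evf] := IHf _ _ fw.
  have /fin_all_exists[sg evg] i := IHg i _ _ (gw i).
  exists (sf + \max_i sg i).
  have gE i : eval_upto (fun c => c \in Y) (sf + \max_i sg i) (g i) v = (tnth w i).+1.
    by apply: mono (evg i); rewrite (leq_trans (leq_bigmax i)) ?leq_addl.
  rewrite (_ : all _ _); last by apply/allP => i _; rewrite gE.
  rewrite (eq_map (fun i => congr1 predn (gE i))) /= map_tnth_enum.
  by apply: mono evf; rewrite leq_addr.
- rewrite /thead (tnth_nth 0).
  elim: (nth 0 v 0) => [|i IHi] /= y; first exact: IHf.
  move=> [t [/IHi[s1 ev1] /IHg[s2 ev2]]]; exists (s1 + s2).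
  (* The value of the recursion at [i] is that of the whole program on the
     argument [i], so monotonicity applies to it. *)
  have /= -> := mono _ _ _ (Prim f g) (i :: behead v) _ (leq_addr s2 s1) ev1.
  exact: mono (leq_addl s1 s2) ev2.
- have [sy evy] := IHf _ _ fy.
  have /fin_all_exists[sf evf] (i : 'I_y) :
      exists s, exists t, eval_upto (fun c => c \in Y) s f (nat_of_ord i :: v) = t.+2.
    by have [t /IHf[s evs]] := fi i (ltn_ord i); exists s, t.
  exists (y.+1 + (sy + \max_i sf i)); apply/mu_belowP; split.
  + by rewrite addSn ltnS leq_addr.
  + by apply: mono evy; lia.
  + move=> i iy; have [t evi] := evf (Ordinal iy).
    rewrite (mono _ _ _ _ _ _ _ evi) //.
    by have := leq_bigmax (F := sf) (Ordinal iy); lia.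
Qed.

Lemma run_functional Y n (e : prog n) (v : n.-tuple nat) y z :
  run Y e v y -> run Y e v z -> y = z.
Proof.
move=> /eval_upto_complete[s evs] /eval_upto_complete[t evt].
have := eval_upto_monotone (leq_addr t s) (fun _ _ => erefl) evs.
by rewrite (eval_upto_monotone (leq_addl s t) (fun _ _ => erefl) evt) => -[].
Qed.

(** The program is fixed, so its evaluator is obtained by recursion on the
program, without any universal program.  The oracle may depend on the context:
it is applied later to finite oracles that are coded by a number. *)
Lemma recursive_eval_upto n (e : prog n) (O : nat -> seq nat -> bool) s
    (a : seq nat -> seq nat) :
  decidable_pred (fun w => O (nth 0 w 0) (behead w)) -> recursive s ->
  (forall i, recursive (fun w => nth 0 (a w) i)) ->
  recursive (fun w => eval_upto (O^~ w) (s w) e (a w)).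
Proof.
elim: e O s a => /= [|||k i|m k f IHf g IHg|k f IHf g IHg|k f IHf] O s a dO rs ra.
- exact: recursive_const.
- exact/recursive_succ/recursive_succ.
- apply: recursive_if; last exact: recursive_const.
    by apply: decidable_leq => //; apply: recursive_succ.
  exact/recursive_succ/(recursive_subst (F := fun c w => O c w)).
- exact: recursive_succ.
- apply: recursive_if; last exact: recursive_const.
    elim: (enum _) => [|i r IHr]; first exact: (@recursive_const 1).
    by apply: decidable_and => //; apply/decidable_neg/decidable_eq0/IHg.
  apply: IHf => // j; case: (ltnP j m) => jm.
    have := recursive_pred (IHg (Ordinal jm) _ _ _ dO rs ra).
    apply: recursive_ext => w; rewrite (nth_map (Ordinal jm)) ?size_enum_ord //.
    by rewrite (nth_ord_enum _ (Ordinal jm)).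
  apply: recursive_ext (@recursive_const 0) => w.
  by rewrite nth_default // size_map size_enum_ord.
- apply: (recursive_nat_rect (st := fun i t w => if t == 0 then 0 else
    eval_upto (O^~ w) (s w) g (i :: t.-1 :: behead (a w)))) => //.
    by apply: IHf => // i; apply: recursive_ext (ra i.+1) => w; rewrite nth_behead.
  apply: recursive_if; first exact/decidable_eq0/recursive_proj.
    exact: recursive_const.
  apply: (IHg (fun c w => O c (behead (behead w))) (fun w => s (behead (behead w)))
    (fun w => nth 0 w 0 :: (nth 0 w 1).-1 :: behead (a (behead (behead w))))).
  + exact: (recursive_weaken (F := fun c w => O c (behead w)))
      (recursive_weaken (F := O) dO).
  + exact: recursive_behead (recursive_behead rs).
  + move=> [|[|i]] /=; first exact: recursive_proj.
      exact/recursive_pred/recursive_proj.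
    apply: recursive_ext (recursive_behead (recursive_behead (ra i.+1))) => w.
    by rewrite nth_behead.
- have rf : recursive (fun w => eval_upto (O^~ (behead w)) (s (behead w)) f
                                  (nth 0 w 0 :: a (behead w))).
    apply: (IHf (fun c w => O c (behead w)) (fun w => s (behead w))
                (fun w => nth 0 w 0 :: a (behead w))).
    + exact: (recursive_weaken (F := O) dO).
    + exact: recursive_behead.
    + by move=> [|i] /=; [exact: recursive_proj|exact: recursive_behead (ra i)].
  apply: (recursive_sum (F := fun y w => if (eval_upto (O^~ w) (s w) f (y :: a w) == 1)
     && all (fun i => 1 < eval_upto (O^~ w) (s w) f (i :: a w)) (iota 0 y)
     then y.+1 else 0)) => //.
  apply: recursive_if; [|exact/recursive_succ/recursive_proj|exact: recursive_const].
  apply: decidable_and; first by apply: decidable_eqn => //; apply: recursive_const.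
  apply: (decidable_all (n := nth 0 ^~ 0) (P := fun i w =>
    1 < eval_upto (O^~ (behead w)) (s (behead w)) f (i :: a (behead w)))).
    exact: recursive_proj.
  apply: decidable_leq; first exact: recursive_const.
  exact: (recursive_weaken (F := fun i w => eval_upto (O^~ w) (s w) f (i :: a w)) rf).
Qed.

(** * Counting nodes of binary trees; density *)

(** Recursion through the two children makes additivity of the measure
definitional; [wsumE] gives the sum over a level. *)
Fixpoint wsum (w : nat -> nat) (s d : nat) : nat :=
  if d is d'.+1 then wsum w s.*2 d' + wsum w s.*2.+1 d' else w s.

Notation population T := (wsum (fun m => nat_of_bool (T m))).

Definition tree (T : nat -> bool) := forall m, T m -> T m./2.
(** The tree [T] has positive measure above [s]. *)
Definition fat (T : nat -> bool) (s : nat) :=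
  exists k, forall d, 2 ^ d <= 2 ^ k * population T s d.
(** Relative measure at least 3/4 above [s]: such a tree has an intersection of
positive measure with every tree of relative measure at least 1/2. *)
Definition dense (T : nat -> bool) (s : nat) :=
  forall d, 3 * 2 ^ d <= 4 * population T s d.

Lemma divn_exp2D m a b : m %/ 2 ^ (a + b) = m %/ 2 ^ a %/ 2 ^ b.
Proof. by rewrite expnD divnMA. Qed.

Lemma divn_exp2S m d : m %/ 2 ^ d.+1 = (m %/ 2 ^ d)./2.
Proof. by rewrite expnSr divnMA divn2. Qed.

Lemma wsum_le w w' s d : (forall m, m %/ 2 ^ d = s -> w m <= w' m) ->
  wsum w s d <= wsum w' s d.
Proof.
elim: d s => [|d IHd] s ww'; first by apply: ww'; rewrite divn1.
by rewrite /= leq_add // IHd // => m mE; apply: ww'; rewrite divn_exp2S mE; lia.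
Qed.

Lemma wsum_eq w w' s d : (forall m, m %/ 2 ^ d = s -> w m = w' m) ->
  wsum w s d = wsum w' s d.
Proof.
by move=> ww'; apply/eqP; rewrite eqn_leq !wsum_le // => m /ww' ->.
Qed.

Lemma wsumD w w' s d :
  wsum (fun m => w m + w' m) s d = wsum w s d + wsum w' s d.
Proof. by elim: d s => //= d IHd s; rewrite !IHd addnACA. Qed.

Lemma wsumZ c w s d : wsum (fun m => c * w m) s d = c * wsum w s d.
Proof. by elim: d s => //= d IHd s; rewrite !IHd mulnDr. Qed.

Lemma wsum1 s d : wsum (fun=> 1) s d = 2 ^ d.
Proof. by elim: d s => //= d IHd s; rewrite !IHd expnS mul2n addnn. Qed.

Lemma wsum_split w s d e : wsum w s (d + e) = wsum (fun m => wsum w m e) s d.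
Proof. by elim: d s => //= d IHd s; rewrite !IHd. Qed.

Lemma wsumE w s d : wsum w s d = \sum_(0 <= j < 2 ^ d) w (s * 2 ^ d + j).
Proof.
elim: d s => [|d IHd] s; first by rewrite big_nat1 muln1 addn0.
rewrite /= !IHd expnS mul2n -[(2 ^ d).*2]addnn.
rewrite [RHS](@big_cat_nat _ _ _ (2 ^ d) 0) ?leq_addr //=; congr (_ + _).
  by apply: eq_bigr => j _; congr w; lia.
rewrite -[2 ^ d in RHS]add0n big_addn !add0n addnK.
by apply: eq_bigr => j _; congr w; lia.
Qed.

Lemma wsum_gt0 T s d : 0 < population T s d -> exists2 m, T m & m %/ 2 ^ d = s.
Proof.
elim: d s => /= [|d IHd] s; first by case Ts: (T s) => // _; exists s; rewrite ?divn1.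
by rewrite addn_gt0 => /orP[] /IHd[m Tm mE]; exists m => //;
  rewrite divn_exp2S mE; lia.
Qed.

Lemma population_le T s d : population T s d <= 2 ^ d.
Proof. by rewrite -(wsum1 s d) wsum_le // => m _; case: (T m). Qed.

Lemma uniform_bound (P : nat -> nat -> Prop) B :
  (forall m h h', h <= h' -> P m h -> P m h') ->
  (forall m, m < B -> exists h, P m h) -> exists h, forall m, m < B -> P m h.
Proof.
move=> monoP; elim: B => [|B IHB] PB; first by exists 0.
have [h hB] := IHB (fun m mB => PB m (ltnW mB)); have [h' PBh'] := PB B (ltnSn B).
exists (h + h') => m; rewrite ltnS leq_eqVlt => /predU1P[->|/hB].
  by apply: monoP PBh'; exact: leq_addl.
by apply: monoP; exact: leq_addr.
Qed.

Lemma exp_gap k : exists i, 2 ^ k * 3 ^ i < 4 ^ i.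
Proof.
exists (3 * k).+1; elim: k => // k IHk; rewrite mulnS -addnS !expnD expnS; nia.
Qed.

Section Trees.
Variables (T : nat -> bool) (treeT : tree T).

Lemma tree_divn m d : T m -> T (m %/ 2 ^ d).
Proof.
by elim: d => [|d IHd] Tm; rewrite ?divn1 // divn_exp2S; apply/treeT/IHd.
Qed.

Lemma population_mono s d e : population T s (d + e) <= 2 ^ e * population T s d.
Proof.
rewrite wsum_split -wsumZ; apply: wsum_le => m _.
case Tm: (T m); first by rewrite muln1 population_le.
rewrite muln0 -(muln0 (2 ^ e)) -[X in _ * X](wsumZ 0 (fun=> 1) m e) -wsumZ.
apply: wsum_le => r rm; case Tr: (T r) => //.
by have := tree_divn e Tr; rewrite rm Tm.
Qed.

(** A finite form of additivity of measure: bounds on the relative measure of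
[T] above the nodes of one level, each visible at its own depth, add up to
a bound above [s]. *)
Lemma population_lim (w : nat -> nat) s d :
  (forall m, m %/ 2 ^ d = s -> exists h, 4 * population T m h <= 2 ^ h * w m) ->
  exists h, 4 * population T s (d + h) <= 2 ^ h * wsum w s d.
Proof.
move=> Tw; pose P m h := m %/ 2 ^ d = s -> 4 * population T m h <= 2 ^ h * w m.
have [|m _|h hP] := @uniform_bound P (s.+1 * 2 ^ d).
- move=> m h h' /subnKC <- Ph /Ph {}Ph.
  rewrite expnD; have := population_mono m h (h' - h); nia.
- by case: (pselect (m %/ 2 ^ d = s)) => [/Tw[h mh]|ms]; [exists h|exists 0 => /ms].
exists h; rewrite wsum_split -!wsumZ; apply: wsum_le => m ms; apply: hP => //.
by rewrite -ltn_divLR ?expn_gt0 // ms.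
Qed.

Lemma fat_in s : fat T s -> T s.
Proof.
move=> [k /(_ 0)] /=; case: (T s) => //; by rewrite muln0.
Qed.

(** The Lebesgue density theorem for trees.  If arbitrarily deep levels had no
node of density 3/4, then the proportion of nodes above [s] would decrease by
the factor 3/4 infinitely often, while [fat] bounds it away from 0.  The node is
found at every sufficiently large depth, so that all strings of a stage can be
extended to a common level. *)
Lemma fat_zoom s : fat T s ->
  exists d0, forall d, d0 <= d -> exists m, m %/ 2 ^ d = s /\ dense T m.
Proof.
move=> [k fatk]; apply: contrapT => nzoom.
have step d : exists h, 4 * population T s (d + h) <= 3 * 2 ^ h * population T s d.
  have [d' [dd' nd']] : exists d', d <= d' /\
      forall m, m %/ 2 ^ d' = s -> ~ dense T m.
    apply: contrapT => nd; apply: nzoom; exists d => d' dd'.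
    apply: contrapT => nm; apply: nd; exists d'; split=> // m ms dm.
    by apply: nm; exists m.
  have [h hE] : exists h, 4 * population T s (d' + h) <=
      2 ^ h * wsum (fun m => 3 * T m) s d'.
    apply: population_lim => m /nd' nd.
    have /existsNP[h /negP] := nd. rewrite -ltnNge => hlt.
    exists h; case Tm: (T m); first by move: hlt; rewrite muln1; lia.
    by have := population_mono m 0 h; rewrite /= Tm add0n; lia.
  exists (d' - d + h); rewrite addnA subnKC //; move: hE; rewrite wsumZ => hE.
  have := population_mono s d (d' - d); rewrite subnKC // => mono.
  rewrite expnD; nia.
have iter i : exists d, 4 ^ i * population T s d <= 3 ^ i * 2 ^ d.
  elim: i => [|i [d IHi]]; first by exists 0; rewrite /= !mul1n; case: (T s).
  have [h hE] := step d; exists (d + h); rewrite !expnS expnD; nia.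
(* The lower bound from [fat] is a fraction [2 ^ - k], the upper bound from
   [iter] a fraction [(3 / 4) ^ i]. *)
have [i gap] := exp_gap k; have [d id] := iter i.
have := fatk d; have : 0 < 2 ^ d by rewrite expn_gt0.
nia.
Qed.

Lemma dense_fat s : dense T s -> fat T s.
Proof. by move=> dT; exists 1 => d; have := dT d; lia. Qed.

(** If one child carried measure 0, then the relative measure above [s] would be
at most 1/2. *)
Lemma dense_children s : dense T s -> fat T s.*2 /\ fat T s.*2.+1.
Proof.
move=> dT; split; exists 1 => d; have := dT d.+1 => /=; rewrite expnS.
  by have := population_le T s.*2.+1 d; lia.
by have := population_le T s.*2 d; lia.
Qed.

(** A node that is not fat contributes less than 1/4 of its subtree at some
depth.  From [3/4 <= x + (1 - x) / 4], with [x] the proportion of fat nodes,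
follows [x >= 2/3]. *)
Lemma dense_fat_part s d : dense T s ->
  2 ^ d <= 2 * population (fun m => `[< fat T m >]) s d.
Proof.
move=> dT.
(* In units of 1/4, a fat node is counted fully, any other node as 1/4. *)
have [h hE] : exists h, 4 * population T s (d + h) <=
    2 ^ h * wsum (fun m => 1 + 3 * `[< fat T m >]) s d.
  apply: population_lim => m _; case: (pselect (fat T m)) => fm.
    by exists 0; rewrite (asboolT fm) /=; case: (T m).
  have /forallNP/(_ 2)/existsNP[h /negP] := fm; rewrite -ltnNge => hlt.
  by exists h; rewrite (asboolF fm) muln1 ltnW.
move: hE; rewrite wsumD wsum1 wsumZ => hE.
have := dT (d + h); rewrite expnD.
have : 0 < 2 ^ h by rewrite expn_gt0.
nia.
Qed.

Lemma dense_inter G s : dense T s ->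
  (forall d, 2 ^ d <= 2 * population G s d) -> fat (fun m => T m && G m) s.
Proof.
move=> dT dG; exists 2 => d; have := dT d; have := dG d.
have : population T s d + population G s d <=
       population (fun m => T m && G m) s d + 2 ^ d.
  rewrite -(wsum1 s d) -!wsumD; apply: wsum_le => m _.
  by case: (T m); case: (G m).
lia.
Qed.
End Trees.

(** * The question asked about a program, and its decidability *)

(** Proves computability by structural recursion on the body of a function of a
list. *)
Ltac recur := cbv beta; lazymatch goal with
 | |- recursive (fun=> ?c) => exact: recursive_const
 | |- recursive (fun v => nth 0 v ?i) => exact: recursive_proj
 | |- recursive (fun v => nat_of_bool (@?P v)) => change (decidable_pred P); recur
 | |- recursive (fun v => @?f v + @?g v) => refine (@recursive_add f g _ _); recur
 | |- recursive (fun v => @?f v * @?g v) => refine (@recursive_mul f g _ _); recur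
 | |- recursive (fun v => @?f v %/ 2 ^ @?g v) =>
     refine (@recursive_divn_exp2 f g _ _); recur
 | |- recursive (fun v => @?f v ^ @?g v) => refine (@recursive_exp f g _ _); recur
 | |- recursive (fun v => (@?f v).+1) => refine (@recursive_succ f _); recur
 | |- recursive (fun v => \sum_(0 <= j < @?n v) (@?F v j)) =>
     refine (@recursive_sum n (fun j v => F v j) _ _); recur
 | |- decidable_pred (fun v => @?f v <= @?g v) => refine (@decidable_leq f g _ _); recur
 | |- decidable_pred (fun v => @?f v == @?g v) => refine (@decidable_eqn f g _ _); recur
 | |- decidable_pred (fun v => @?f v \in ?L) => refine (@decidable_mem L f _); recur
 | |- decidable_pred (fun v => odd (@?f v)) => refine (@decidable_odd f _); recur
 | |- decidable_pred (fun v => @?P v && @?Q v) => refine (@decidable_and P Q _ _); recur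
 | |- decidable_pred (fun v => @?P v || @?Q v) => refine (@decidable_or P Q _ _); recur
 | |- decidable_pred (fun v => @?P v ==> @?Q v) =>
     refine (@decidable_imply P Q _ _); recur
 | |- decidable_pred (fun v => has (@?P v) (iota 0 (@?n v))) =>
     refine (@decidable_has n (fun i v => P v i) _ _); recur
 | |- decidable_pred (fun v => all (@?P v) (iota 0 (@?n v))) =>
     refine (@decidable_all n (fun i v => P v i) _ _); recur
 | |- recursive (fun v => nth 0 (behead (@?s v)) ?i) =>
     refine (@recursive_ext (fun v => nth 0 (s v) i.+1) _
               (fun w => esym (nth_behead 0 (s w) i)) _); recur
 | |- recursive (fun v => eval_upto (@?O v) (@?s v) ?e (@?a v)) =>
     refine (@recursive_eval_upto _ e (fun c v => O v c) s a _ _ _); recur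
 | |- _ => idtac
 end.

(** Minimization finds a confirmation of one of the two values, and the
confirmed value is the correct one. *)
Lemma computable_search (X : set nat) (Q : nat -> nat -> nat -> bool) :
  decidable_pred (fun v => Q (nth 0 v 0) (nth 0 v 1) (nth 0 v 2)) ->
  (forall n, exists d, Q d n (n \in X)) ->
  (forall n d, ~~ Q d n (n \notin X)) -> computable X.
Proof.
move=> dQ QX QnX.
have dQb b : decidable_pred (fun v => Q (nth 0 v 0) (nth 0 v 1) b).
  move=> k; pose G i := nth (fun=> b) [:: nth 0 ^~ 0; nth 0 ^~ 1] i.
  apply: (@recursive_at_comp 3 k
    (fun v => Q (nth 0 v 0) (nth 0 v 1) (nth 0 v 2)) G (dQ 3)) => -[|[|i]] _ /=.
  - exact: recursive_proj.
  - exact: recursive_proj.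
  - by rewrite /G /= nth_nil; apply: recursive_const.
have [eq [ofq runq]] := decidable_neg (decidable_or (dQb 0) (dQb 1)) 2.
have [er [ofr runr]] := dQb 1 2.
exists (Comp er (fun i : 'I_2 => if i == ord0 then Mu eq else Proj ord0)).
split; first by split=> // i; case: eqP.
move=> n; have Qdec d : Q d n 0 || Q d n 1 = Q d n (n \in X).
  by have := QnX n d; case: (n \in X) => /= /negbTE ->; rewrite ?orbF.
have [d Qd dmin] := ex_minnP (QX n).
exists [tuple d; n]; split.
  move=> i; case: (unliftP ord0 i) => [j|] -> /=; last first.
    split; first by have := runq [tuple d; n]; rewrite /= Qdec Qd; apply.
    move=> d' d'd; exists 0; have := runq [tuple d'; n]; rewrite /= Qdec.
    case Qd': (Q d' n _); last by apply.
    by rewrite ltnNge dmin in d'd.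
  by rewrite (tnth_nth 0) /= [j]ord1.
have := runr [tuple d; n]; rewrite /=; congr (run _ _ _ _).
by have := QnX n d; move: Qd; case: (n \in X) => /= [->//|_ /negbTE ->].
Qed.

(** Evaluations with bounded resources query short strings only, so a set of
nodes on one deep level can stand for a tree. *)
Definition oracle_of (t : nat -> bool) (c : nat) : bool :=
  `[< exists m l, t m /\ m %/ 2 ^ l = c.+1 >].

(** [G] ranges over all candidates for the unknown tree of the stage.  Only
depth [d] of [G] matters and the evaluation is bounded, so this is a finite
question.  The members of [t] are the extended strings. *)
Definition forced (L : seq nat) (e : prog 1) (d n b : nat) : Prop :=
  forall G : nat -> bool,
    (forall s, s \in L -> 2 ^ d <= 2 * population G s d) ->
    exists t : nat -> bool,
      [/\ forall m, t m -> G m /\ m %/ 2 ^ d \in L,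
          forall s, s \in L -> exists2 m, t m & m %/ 2 ^ d = s
        & eval_upto (oracle_of t) d e [:: n] = b.+1].

Definition bit (g m : nat) : bool := odd (g %/ 2 ^ m).

(** Finite sets of nodes are coded by the binary digits of a number. *)
Lemma bits_exist (G : nat -> bool) B :
  exists2 g, g < 2 ^ B & forall m, m < B -> bit g m = G m.
Proof.
elim: B G => [|B IHB] G; first by exists 0.
have [g gB gG] := IHB (fun m => G m.+1).
exists (G 0 + g.*2); first by rewrite expnS; case: (G 0); lia.
case=> [_|m mB]; rewrite /bit; first by rewrite divn1 oddD odd_double addbF oddb.
by rewrite expnS divnMA divn2 half_bit_double; apply: gG.
Qed.

(** The question [forced] is rewritten with all quantifiers bounded, over
binary codes of finite sets.  Every node at depth [d] above [L] is less than
[K * 2 ^ d]. *)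
Section CodedQuestion.
Variables (L : seq nat) (e : prog 1).
Let K := (\max_(s <- L) s).+1.

Definition coded_large g d : bool :=
  all (fun s : nat => (s \in L) ==>
         (2 ^ d <= 2 * \sum_(0 <= j < 2 ^ d) bit g (s * 2 ^ d + j)))
      (iota 0 K).

Definition coded_oracle t d c : bool :=
  has (fun m => (bit t m && (m %/ 2 ^ d \in L)) &&
                has (fun l => m %/ 2 ^ l == c.+1) (iota 0 (K * 2 ^ d)))
      (iota 0 (K * 2 ^ d)).

Definition coded_sub t g d : bool :=
  all (fun m => (bit t m && (m %/ 2 ^ d \in L)) ==> bit g m)
      (iota 0 (K * 2 ^ d)).

Definition coded_meets t d : bool :=
  all (fun s : nat => (s \in L) ==>
         has (fun m => bit t m && (m %/ 2 ^ d == s)) (iota 0 (K * 2 ^ d)))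
      (iota 0 K).

Definition coded_forced d n b : bool :=
  all (fun g => coded_large g d ==>
    has (fun t => (coded_sub t g d && coded_meets t d) &&
                  (eval_upto (coded_oracle t d) d e [:: n] == b.+1))
        (iota 0 (2 ^ (K * 2 ^ d))))
    (iota 0 (2 ^ (K * 2 ^ d))).

Lemma decidable_coded_forced :
  decidable_pred (fun v => coded_forced (nth 0 v 0) (nth 0 v 1) (nth 0 v 2)).
Proof.
rewrite /coded_forced /coded_oracle /coded_large /coded_sub /coded_meets /bit.
recur.
by move=> [|i] /=; [recur | rewrite nth_nil; recur].
Qed.

Lemma above_lt m d : m %/ 2 ^ d \in L -> m < K * 2 ^ d.
Proof.
rewrite -ltn_divLR ?expn_gt0 // ltnS => mL.
exact: (leq_bigmax_seq (F := id)).
Qed.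

Lemma coded_oracleE t (T : nat -> bool) d :
  (forall m, T m = bit t m && (m %/ 2 ^ d \in L)) ->
  coded_oracle t d =1 oracle_of T.
Proof.
move=> TE c; apply/hasP/asboolP => [[m _ /andP[]]|[m [l []]]].
  by move=> tm /hasP[l _ /eqP ml]; exists m, l; rewrite TE.
rewrite TE => tm ml; have mB : m < K * 2 ^ d by apply: above_lt; case/andP: tm.
exists m; first by rewrite mem_iota.
rewrite tm; apply/hasP; exists l; last exact/eqP.
rewrite mem_iota /= add0n; apply: leq_ltn_trans mB.
apply: leq_trans (ltnW (ltn_expl l (isT : 1 < 2))) _.
have : 0 < m %/ 2 ^ l by rewrite ml.
by rewrite divn_gt0 ?expn_gt0.
Qed.

Lemma eval_upto_eq_oracle O O' s n (f : prog n) v :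
  O =1 O' -> eval_upto O s f v = eval_upto O' s f v.
Proof. by move=> /funext ->. Qed.

Lemma population_bits g (G : nat -> bool) s d : s \in L ->
  (forall m, m < K * 2 ^ d -> bit g m = G m) ->
  \sum_(0 <= j < 2 ^ d) bit g (s * 2 ^ d + j) = population G s d.
Proof.
move=> sL gG; rewrite wsumE; apply: eq_big_nat => j /andP[_ jd].
rewrite gG //; apply: above_lt.
by rewrite divnMDl ?expn_gt0 // divn_small // addn0.
Qed.

Lemma coded_forcedP d n b : coded_forced d n b <-> forced L e d n b.
Proof.
split=> [/allP Q G largeG|forcedQ].
  have [g gB gG] := bits_exist G (K * 2 ^ d).
  have gI : g \in iota 0 (2 ^ (K * 2 ^ d)) by rewrite mem_iota.
  have largeg : coded_large g d.
    apply/allP => s _; apply/implyP => sL.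
    by rewrite (population_bits sL gG) largeG.
  have := Q g gI; rewrite largeg /=.
  move=> /hasP[t _ /andP[/andP[/allP sub /allP meets] /eqP evt]].
  exists (fun m => bit t m && (m %/ 2 ^ d \in L)); split.
  - move=> m /andP[tm mL]; have mB := above_lt mL; split=> //.
    by have := sub m; rewrite mem_iota mB tm mL gG // => /(_ isT).
  - move=> s sL; have := meets s; rewrite mem_iota sL /= add0n.
    rewrite ltnS (leq_bigmax_seq (F := id)) // => /(_ isT)/hasP[m _].
    by move=> /andP[tm /eqP ms]; exists m; rewrite ?tm ?ms.
  - by rewrite -(eval_upto_eq_oracle _ _ _ (coded_oracleE (fun=> erefl))).
apply/allP => g _; apply/implyP => /allP largeg.
have [s sL|T [Tsub Tmeets evT]] := forcedQ (bit g).
  have := largeg s; rewrite mem_iota sL /= add0n.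
  rewrite ltnS (leq_bigmax_seq (F := id)) // => /(_ isT).
  by rewrite (population_bits (G := bit g)).
have [t tB tT] := bits_exist T (K * 2 ^ d).
have TE m : T m = bit t m && (m %/ 2 ^ d \in L).
  case mL: (m %/ 2 ^ d \in L); first by rewrite tT ?above_lt ?andbT.
  by rewrite andbF; apply/negP => /Tsub[]; rewrite mL.
apply/hasP; exists t; first by rewrite mem_iota.
rewrite (eval_upto_eq_oracle _ _ _ (coded_oracleE TE)) evT eqxx andbT.
apply/andP; split.
  by apply/allP => m _; apply/implyP; rewrite -TE => /Tsub[].
apply/allP => s _; apply/implyP => /Tmeets[m Tm ms]; apply/hasP; exists m.
  by rewrite mem_iota /= above_lt //; case: (Tsub m Tm).
by rewrite ms eqxx andbT; move: Tm; rewrite TE => /andP[].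
Qed.

End CodedQuestion.

(** The only place where non-computability of [X] is used. *)
Lemma not_computable_question (X : set nat) L e : ~ computable X ->
  (exists n d, forced L e d n (n \notin X)) \/
  (exists n, forall d, ~ forced L e d n (n \in X)).
Proof.
move=> nX; apply: contrapT => /not_orP[noX yesX]; apply: nX.
apply: (computable_search (decidable_coded_forced L e)) => [n|n d].
  apply: contrapT => nd; apply: yesX; exists n => d /coded_forcedP Qd.
  by apply: nd; exists d.
by apply/negP => /coded_forcedP Qd; apply: noX; exists n, d.
Qed.

(** * Stages of the construction *)

(** Compactness of Cantor space, in the form in which it is used: a sequence of
sets has a cluster point, obtained here as a limit along an ultrafilter. *)
Lemma cluster_bits (u : nat -> nat -> bool) :
  exists G : nat -> bool,
    forall B D, exists2 d, D <= d & forall m, m < B -> u d m = G m.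
Proof.
have [U [UU ooU]] := ultraFilterLemma (eventually_filter : ProperFilter (\oo)%classic).
pose G m := `[< U [set d | u d m] >]%classic; exists G => B D.
have UuG m : U [set d | u d m = G m]%classic.
  rewrite /G; case: asboolP => [|nU]; first by apply: filterS => d.
  have [//|] := in_ultra_setVsetC [set d | u d m]%classic UU.
  by apply: filterS => d /negP/negbTE.
have UB : U [set d | forall m, m < B -> u d m = G m]%classic.
  elim: B => [|B IHB]; first by apply: filterS filterT => d _ m.
  apply: filterS2 IHB (UuG B) => d uB uBB m.
  by rewrite ltnS leq_eqVlt => /predU1P[->|/uB].
have UD : U [set d | D <= d]%classic by apply: ooU; exists D.
by have [d [uB Dd]] := filter_ex (filterI UB UD); exists d.
Qed.

Lemma level_uniq m a b : m %/ 2 ^ a = 1 -> m %/ 2 ^ b = 1 -> a = b.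
Proof.
wlog ab : a b / a <= b => [wlog_ab ma mb|ma].
  by case: (leqP a b) => [|/ltnW] ab; [|apply: esym]; exact: wlog_ab.
rewrite -(subnKC ab) divn_exp2D ma; case: (b - a) => [|d]; first by rewrite addn0.
by rewrite divn_small // -{1}[1]/(2 ^ 0) ltn_exp2l.
Qed.

Lemma level_exists m : 0 < m -> exists a, m %/ 2 ^ a = 1.
Proof.
move=> m0; exists (trunc_log 2 m); apply/eqP; rewrite eqn_leq divn_gt0 ?expn_gt0 //.
by rewrite trunc_logP // -ltnS ltn_divLR ?expn_gt0 // -expnS trunc_log_ltn.
Qed.

(** The members of [nodes] are on level [height]; [body] is the tree in which
later stages must remain. *)
Record stage := Stage {height : nat; nodes : seq nat; body : nat -> bool}.

Definition valid (c : stage) : Prop :=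
  [/\ exists s, s \in nodes c, forall s, s \in nodes c -> s %/ 2 ^ height c = 1,
      tree (body c) & forall s, s \in nodes c -> fat (body c) s].

Definition extends (c' c : stage) : Prop :=
  let d := height c' - height c in
  [/\ height c <= height c', forall m, body c' m -> body c m,
      forall s, s \in nodes c' -> s %/ 2 ^ d \in nodes c
    & forall s, s \in nodes c -> exists2 s', s' \in nodes c' & s' %/ 2 ^ d = s].

Lemma extends_refl c0 : extends c0 c0.
Proof.
rewrite /extends subnn; split=> // s sc; first by rewrite divn1.
by exists s; rewrite ?divn1.
Qed.

Lemma extends_trans c2 c1 c3 : extends c3 c2 -> extends c2 c1 -> extends c3 c1.
Proof.
move=> [h23 b23 n23 m23] [h12 b12 n12 m12].
have hE : height c3 - height c1 =
    (height c3 - height c2) + (height c2 - height c1).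
  by clear -h12 h23; lia.
split; first exact: leq_trans h23.
- by move=> m /b23/b12.
- by move=> s /n23/n12; rewrite hE divn_exp2D.
- by move=> s /m12[s2 /m23[s3 s3c <-] <-]; exists s3; rewrite // hE divn_exp2D.
Qed.

Lemma stage_zoom c : valid c -> exists c',
  [/\ valid c', extends c' c & forall s, s \in nodes c' -> dense (body c') s].
Proof.
move=> [[s0 s0c] lev treeT fatT].
have [d dP] : exists d, forall s, s \in nodes c ->
    exists m, m %/ 2 ^ d = s /\ dense (body c) m.
  have [||d dP] := @uniform_bound (fun s h => s \in nodes c -> forall d, h <= d ->
    exists m, m %/ 2 ^ d = s /\ dense (body c) m) (\max_(s <- nodes c) s).+1.
  - by move=> s h h' hh' Ph /Ph {}Ph d h'd; apply/Ph/(leq_trans hh').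
  - move=> s _; case: (boolP (s \in nodes c)) => [/fatT/(fat_zoom treeT)[d dP]|_].
      by exists d.
    by exists 0.
  exists d => s sc; apply: (dP s _ sc d (leqnn d)).
  by rewrite ltnS (leq_bigmax_seq (F := id)).
have /choice[f fP] (s : nat) : exists m, s \in nodes c ->
    m %/ 2 ^ d = s /\ dense (body c) m.
  by case: (boolP (s \in nodes c)) => [/dP[m mP]|_]; [exists m|exists 0].
exists (Stage (height c + d) [seq f s | s <- nodes c] (body c)).
split; last by move=> _ /mapP[s /fP[_ ds] ->].
- split=> //=.
  + by exists (f s0); apply: map_f.
  + move=> _ /mapP[s sc ->]; rewrite addnC divn_exp2D; have [-> _] := fP _ sc.
    exact: lev.
  + by move=> _ /mapP[s /fP[_ ds] ->]; apply: dense_fat.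
- rewrite /extends /= addKn leq_addr; split=> //.
  + by move=> _ /mapP[s sc ->]; have [-> _] := fP _ sc.
  + by move=> s sc; exists (f s); [apply: map_f|case: (fP _ sc)].
Qed.

Lemma stage_split c : valid c -> exists c',
  [/\ valid c', extends c' c, height c < height c' &
      forall s, s \in nodes c -> exists s1 s2,
        [/\ s1 != s2, s1 \in nodes c', s2 \in nodes c' &
            s1 %/ 2 ^ (height c' - height c) = s /\
            s2 %/ 2 ^ (height c' - height c) = s]].
Proof.
move=> /stage_zoom[c1 [[[s0 s0c] lev treeT fatT] [hle bs sub meets] dn]].
set c' := Stage (height c1).+1
  ([seq s.*2 | s <- nodes c1] ++ [seq s.*2.+1 | s <- nodes c1]) (body c1).
have div0 s k : s.*2 %/ 2 ^ k.+1 = s %/ 2 ^ k by rewrite expnS divnMA divn2 doubleK.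
have div1 s k : s.*2.+1 %/ 2 ^ k.+1 = s %/ 2 ^ k.
  by rewrite expnS divnMA divn2 /= uphalf_double.
have in0 s : s \in nodes c1 -> s.*2 \in nodes c'.
  by move=> sc; rewrite mem_cat map_f.
have in1 s : s \in nodes c1 -> s.*2.+1 \in nodes c'.
  by move=> sc; rewrite mem_cat (map_f (fun s => s.*2.+1)) ?orbT.
have casec (Q : nat -> Prop) : (forall s, s \in nodes c1 -> Q s.*2 /\ Q s.*2.+1) ->
    forall s, s \in nodes c' -> Q s.
  by move=> QH s; rewrite mem_cat => /orP[] /mapP[r /QH[]] ? ? ->.
exists c'; split.
- split=> //; first by exists s0.*2; apply: in0.
    by apply: casec => s sc; rewrite /= div0 div1 lev.
  by apply: casec => s /dn /dense_children.
- rewrite /extends /= subSn //; split=> //; first exact: leqW.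
    by apply: casec => s sc; rewrite div0 div1 sub.
  by move=> s /meets[s1 s1c <-]; exists s1.*2; [apply: in0|rewrite div0].
- by rewrite /= ltnS.
- move=> s /meets[s1 s1c <-]; exists s1.*2, s1.*2.+1; rewrite /= subSn // div0 div1.
  by split=> //; [lia|apply: in0|apply: in1].
Qed.

(** The trees of initial segments of closed sets: closed under nonempty
prefixes, and without dead ends. *)
Definition pruned (P : nat -> bool) : Prop :=
  (forall m l, P m -> 0 < m %/ 2 ^ l -> P (m %/ 2 ^ l)) /\
  (forall m d, P m -> exists2 m', P m' & m' %/ 2 ^ d = m).

Definition passes (P : nat -> bool) (c : stage) : Prop :=
  (forall s, s %/ 2 ^ height c = 1 -> P s = (s \in nodes c)) /\
  (forall m, P m -> body c m).

(** Undoes the shift by one between integers and [string_code]. *)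
Definition codes (P : nat -> bool) : set nat := [set c | P c.+1]%classic.

(** One level of a pruned tree determines all shorter strings, so it answers all
queries below [h]. *)
Lemma oracle_of_level P h c : pruned P -> c < h ->
  oracle_of (fun m => P m && (m %/ 2 ^ h == 1)) c = (c \in codes P).
Proof.
move=> [Pdiv Pext] ch; rewrite /codes (_ : (c \in _) = P c.+1); last first.
  by apply/idP/idP; rewrite inE.
apply/asboolP/idP => [[m [l [/andP[Pm _] ml]]]|Pc].
  by rewrite -ml; apply: Pdiv; rewrite ?ml.
have [a ca] := @level_exists c.+1 isT.
have ah : a <= h.
  rewrite leqNgt; apply/negP => ha.
  have : 2 ^ a <= c.+1 by rewrite -divn_gt0 ?expn_gt0 // ca.
  have : h < 2 ^ h by apply: ltn_expl.
  have : 2 ^ h <= 2 ^ a by rewrite leq_exp2l // ltnW.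
  lia.
have [m Pm mc] := Pext _ (h - a) Pc; exists m, (h - a); rewrite Pm mc; split=> //.
by rewrite -(subnK ah) divn_exp2D mc ca.
Qed.

(** * Defeating one program *)

(** The fat nodes of the body form an admissible [G], so the extension
found can serve as the nodes of a new stage with the same body. *)
Lemma stage_force_wrong c e d n b :
  valid c -> (forall s, s \in nodes c -> dense (body c) s) ->
  forced (nodes c) e d n b ->
  exists c', [/\ valid c', extends c' c &
    forall P, pruned P -> passes P c' -> run (codes P) e [tuple n] b].
Proof.
move=> [[s0 s0c] lev treeT fatT] dn fd.
have [s /dn ds|t [tsub tmeets evt]] := fd (fun m => `[< fat (body c) m >]).
  exact: dense_fat_part.
pose c' := Stage (height c + d)
  [seq m <- iota 0 ((\max_(s <- nodes c) s).+1 * 2 ^ d) | t m] (body c).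
have c'E m : (m \in nodes c') = t m.
  rewrite mem_filter mem_iota andb_idr // => /tsub[_ mL].
  by rewrite leq0n add0n above_lt.
have levt m : t m -> m %/ 2 ^ (height c + d) = 1.
  by move=> /tsub[_ mL]; rewrite addnC divn_exp2D lev.
exists c'; split.
- split=> //.
  + by have [m tm _] := tmeets _ s0c; exists m; rewrite c'E.
  + by move=> m; rewrite c'E => /levt.
  + by move=> m; rewrite c'E => /tsub[/asboolP].
- rewrite /extends /= addKn leq_addr; split=> //.
  + by move=> m; rewrite c'E => /tsub[].
  + by move=> s /tmeets[m tm ms]; exists m; rewrite ?c'E.
- move=> P prP [Pc' _]; apply: eval_upto_sound evt => i id.
  rewrite -(oracle_of_level prP (ltn_addl (height c) id)); congr oracle_of.
  apply/funext => m; apply/idP/andP => [tm|[Pm /eqP lm]].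
    by have lm := levt _ tm; rewrite lm Pc' ?c'E.
  by rewrite -c'E -Pc'.
Qed.

(** The case of a negative answer at every depth. *)
Section AvoidValue.
Variables (c : stage) (e : prog 1) (n b : nat).
Hypotheses (validc : valid c)
  (densec : forall s, s \in nodes c -> dense (body c) s)
  (unforced : forall d, ~ forced (nodes c) e d n b).
Let L := nodes c.

Let bad d (G : nat -> bool) : Prop :=
  (forall s, s \in L -> 2 ^ d <= 2 * population G s d) /\
  forall t : nat -> bool, (forall m, t m -> G m /\ m %/ 2 ^ d \in L) ->
    (forall s, s \in L -> exists2 m, t m & m %/ 2 ^ d = s) ->
    eval_upto (oracle_of t) d e [:: n] <> b.+1.

(** At each depth [d] there is a counterexample [H d] to [forced].  A cluster
point [G] of the sets of prefixes of the [H d] is a tree, is as large as the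
[H d], and each of its levels consists of prefixes of a counterexample at some
greater depth. *)
Lemma bad_tree : exists G : nat -> bool,
  [/\ tree G, forall s, s \in L -> forall d, 2 ^ d <= 2 * population G s d &
      forall d, exists d' H, [/\ d <= d', bad d' H &
        forall m, G m -> m %/ 2 ^ d \in L ->
          exists2 m', H m' /\ m' %/ 2 ^ d' \in L & m' %/ 2 ^ (d' - d) = m]].
Proof.
have [_ lev _ _] := validc.
have /choice[H badH] d : exists G, bad d G.
  apply: contrapT => nbad; apply: (unforced (d := d)) => G largeG.
  apply: contrapT => nt; apply: nbad; exists G; split=> // t ts tm evt.
  by apply: nt; exists t.
pose u d m := `[< exists m' l, [/\ H d m', m' %/ 2 ^ d \in L & m' %/ 2 ^ l = m] >].
have [G GP] := cluster_bits u; exists G; split.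
- move=> m Gm; have [d _ uG] := GP m.+1 0.
  rewrite -uG; last by rewrite ltnS; lia.
  have := uG m (ltnSn m); rewrite Gm => /asboolP[m' [l [Hm' m'L m'm]]].
  by apply/asboolP; exists m', l.+1; rewrite divn_exp2S m'm.
- move=> s sL d; have [d' dd' uG] := GP ((\max_(s <- L) s).+1 * 2 ^ d) d.
  rewrite -(@wsum_eq (fun m => u d' m)); last first.
    by move=> m ms; rewrite uG // above_lt // ms.
  have [largeH _] := badH d'; have := largeH _ sL.
  have : population (H d') s d' <= 2 ^ (d' - d) * population (u d') s d.
    rewrite -{2}(subnKC dd') wsum_split -wsumZ; apply: wsum_le => m ms.
    case um: (u d' m); first by rewrite muln1 population_le.
    rewrite muln0 leqn0; apply/negP => /negP; rewrite -lt0n.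
    move=> /wsum_gt0[m' Hm' m'm]; move/asboolP: um; apply.
    exists m', (d' - d); split=> //.
    by rewrite -(subnK dd') divn_exp2D m'm ms.
  have -> : 2 ^ d' = 2 ^ (d' - d) * 2 ^ d by rewrite -expnD subnK.
  have : 0 < 2 ^ (d' - d) by rewrite expn_gt0.
  nia.
- move=> d; have [d' dd' uG] := GP ((\max_(s <- L) s).+1 * 2 ^ d) d.
  exists d', (H d'); split=> // m Gm mL; move: Gm.
  rewrite -uG ?above_lt // => /asboolP[m' [l [Hm' m'L m'm]]].
  exists m' => //; rewrite -m'm.
  (* Comparing levels identifies the length difference [l]. *)
  have lE : l + (d + height c) = d' + height c.
    apply: (@level_uniq m'); first by rewrite divn_exp2D m'm divn_exp2D lev.
    by rewrite divn_exp2D lev.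
  by congr (m' %/ 2 ^ _); lia.
Qed.

(** If a pruned tree inside [G] led to the output [b], then one of its levels
would already do so.  Each node of this level has an extension in a
counterexample [H] at greater depth; these extensions induce the same oracle on
short strings, contrary to the choice of [H]. *)
Lemma stage_avoid : exists c', [/\ valid c', extends c' c &
  forall P, pruned P -> passes P c' -> ~ run (codes P) e [tuple n] b].
Proof.
have [[s0 s0c] lev treeT fatT] := validc.
have [G [treeG largeG GP]] := bad_tree.
exists (Stage (height c) L (fun m => body c m && G m)); split.
- split=> //=; first by exists s0.
    by move=> m /andP[/treeT -> /treeG ->].
  by move=> s sL; apply: dense_inter; [exact: densec | exact: largeG].
- rewrite /extends /= subnn; split=> //; first by move=> m /andP[].
    by move=> s sL; rewrite divn1.
  by move=> s sL; exists s; rewrite ?divn1.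
- move=> P prP [PL PG] /eval_upto_complete[d evd].
  have [d' [H [dd' [_ badH] HP]]] := GP d.
  pose t m := P m && (m %/ 2 ^ (height c + d) == 1).
  have tL m : t m -> m %/ 2 ^ d \in L.
    move=> /andP[Pm /eqP lm]; have lm' : m %/ 2 ^ d %/ 2 ^ height c = 1.
      by rewrite -divn_exp2D addnC.
    rewrite -PL //; apply: prP.1 => //; rewrite lt0n; apply/eqP => m0.
    by rewrite m0 div0n in lm'.
  have tH m : t m -> exists2 m', H m' /\ m' %/ 2 ^ d' \in L & m' %/ 2 ^ (d' - d) = m.
    by move=> tm; apply: HP (tL _ tm); have /andP[/PG/andP[]] := tm.
  pose t' m := [&& H m, m %/ 2 ^ d' \in L & t (m %/ 2 ^ (d' - d))].
  apply: (badH t').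
  + by move=> m /and3P[].
  + move=> s sL; have Ps : P s by rewrite PL ?lev.
    have [m Pm ms] := prP.2 s d Ps.
    have tm : t m by rewrite /t Pm addnC divn_exp2D ms lev.
    have [m' [Hm' m'L] m'm] := tH _ tm; exists m'; first by rewrite /t' Hm' m'L m'm.
    by rewrite -(subnK dd') divn_exp2D m'm ms.
  + apply: eval_upto_monotone dd' _ evd => i id.
    rewrite -(oracle_of_level prP (ltn_addl (height c) id)) -/t.
    apply/asboolP/asboolP => [[m [l [tm ml]]]|[m [l [/and3P[Hm mL tm] ml]]]].
      have [m' [Hm' m'L] m'm] := tH _ tm; exists m', (d' - d + l).
      by rewrite /t' Hm' m'L m'm divn_exp2D m'm ml.
    (* For smaller [l] the prefix would be too long to have a code below [d]. *)
    have dl : d' - d <= l.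
      rewrite leqNgt; apply/negP => ld.
      have : i.+1 %/ 2 ^ (d' - l + height c) = 1.
        rewrite -ml -divn_exp2D addnA subnKC; last by lia.
        by rewrite divn_exp2D lev.
      have : d < 2 ^ d by apply: ltn_expl.
      have : 2 ^ d <= 2 ^ (d' - l + height c) by rewrite leq_exp2l //; lia.
      by move=> ? ?; rewrite divn_small //; lia.
    exists (m %/ 2 ^ (d' - d)), (l - (d' - d)); split=> //.
    by rewrite -divn_exp2D subnKC.
Qed.
End AvoidValue.

Lemma stage_force X c e : ~ computable X -> valid c -> exists c',
  [/\ valid c', extends c' c & forall P, pruned P -> passes P c' ->
      ~ decides (codes P) e X].
Proof.
move=> /not_computable_question nX /stage_zoom[c1 [v1 x1 d1]].
have [[n [d fn]]|[n nf]] := nX (nodes c1) e.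
  have [c2 [v2 x2 wrong]] := stage_force_wrong v1 d1 fn.
  exists c2; split=> //; first exact: extends_trans x1.
  move=> P prP Pc2 /(_ n) /run_functional /(_ (wrong _ prP Pc2)).
  by case: (n \in X).
have [c2 [v2 x2 avoid]] := stage_avoid v1 d1 nf.
exists c2; split=> //; first exact: extends_trans x1.
by move=> P prP Pc2 /(_ n); apply: avoid.
Qed.

(** * Enumerating programs *)

(** A default value, which exists at every arity. *)
Definition zero_prog n : prog n :=
  Comp Zero (fun i : 'I_0 => let: Ordinal _ i0 := i in match notF i0 with end).

(** Labelled trees form a countable type, and decoding them avoids deciding
equality of the dependently typed programs.  The arity of the outer program
of a composition is stored in the label, so that it need not be recovered from
the length of the list of inner programs. *)
Fixpoint decode (t : GenTree.tree nat) (n : nat) : prog n :=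
  match t with
  | GenTree.Leaf i => if insub i is Some j then Proj j else zero_prog n
  | GenTree.Node 0 _ => if n is 0 then Zero else zero_prog _
  | GenTree.Node 1 _ => if n is 1 then Succ else zero_prog _
  | GenTree.Node 2 _ => if n is 1 then Oracle else zero_prog _
  | GenTree.Node 3 [:: f; g] =>
      if n is k.+1 then Prim (decode f k) (decode g k.+2) else zero_prog _
  | GenTree.Node 4 [:: f] => Mu (decode f n.+1)
  | GenTree.Node m.+4.+1 (f :: gs) =>
      Comp (decode f m)
        (fun i : 'I_m => nth (zero_prog n) [seq decode g n | g <- gs] i)
  | _ => zero_prog n
  end.

Lemma decode_surjective n (e : prog n) : exists t, decode t n = e.
Proof.
elim: e => [|||k i|m k f [tf <-] g IHg|k f [tf <-] g [tg <-]|k f [tf <-]].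
- by exists (GenTree.Node 0 [::]).
- by exists (GenTree.Node 1 [::]).
- by exists (GenTree.Node 2 [::]).
- by exists (GenTree.Leaf (val i)); rewrite /= valK.
- have /choice[tg tgP] := IHg.
  exists (GenTree.Node m.+4.+1 (tf :: [seq tg i | i <- enum 'I_m])) => /=.
  congr Comp; apply/funext => i; rewrite -map_comp (nth_map i) ?size_enum_ord //.
  by rewrite nth_ord_enum /=.
- by exists (GenTree.Node 3 [:: tf; tg]).
- by exists (GenTree.Node 4 [:: tf]).
Qed.

Lemma prog_enumeration n : exists E : nat -> prog n, forall e, exists k, E k = e.
Proof.
exists (fun k => if unpickle k is Some t then decode t n else zero_prog n) => e.
by have [t <-] := decode_surjective e; exists (pickle t); rewrite pickleK.
Qed.

(** * The fusion of a sequence of stages *)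

Definition splits (c' c : stage) : Prop :=
  forall s, s \in nodes c -> exists s1 s2,
    [/\ s1 != s2, s1 \in nodes c', s2 \in nodes c' &
        s1 %/ 2 ^ (height c' - height c) = s /\
        s2 %/ 2 ^ (height c' - height c) = s].

Lemma splits_extends c2 c1 c3 : extends c3 c2 -> extends c2 c1 ->
  splits c2 c1 -> splits c3 c1.
Proof.
move=> [h23 _ _ m23] [h12 _ _ _] sp s.
move=> /sp[s1 [s2 [s12 /m23[r1 r1c r1s] /m23[r2 r2c r2s] [s1s s2s]]]].
have hE : height c3 - height c1 =
    (height c3 - height c2) + (height c2 - height c1).
  by clear -h12 h23; lia.
exists r1, r2; rewrite hE !divn_exp2D r1s r2s; split=> //.
by apply: contraNneq s12 => r12; rewrite -r1s -r2s r12.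
Qed.

(** Splitting and defeating the next program alternate. *)
Lemma fusion_sequence X c0 : ~ computable X -> valid c0 ->
  exists c : nat -> stage,
    [/\ c 0 = c0, forall k, valid (c k),
        forall k, [/\ extends (c k.+1) (c k), height (c k) < height (c k.+1)
                    & splits (c k.+1) (c k)]
      & forall P, pruned P -> (forall k, passes P (c k)) ->
          ~ (X <=_T codes P)].
Proof.
move=> nX v0; have [E Esurj] := prog_enumeration 1.
(* The choice is made for all stages, valid or not, so that the sequence can
   be defined by plain recursion. *)
have /choice[next nextP] (kc : nat * stage) : exists c',
    valid kc.2 -> [/\ valid c', [/\ extends c' kc.2, height kc.2 < height c'
                    & splits c' kc.2]
      & forall P, pruned P -> passes P c' -> ~ decides (codes P) (E kc.1) X].
  case: kc => k c /=; case: (pselect (valid c)) => [vc|]; last by exists c.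
  have [c1 [v1 x1 h1 sp1]] := stage_split vc.
  have [c2 [v2 x2 d2]] := stage_force (E k) nX v1.
  exists c2 => _; split=> //; split; first exact: extends_trans x2 x1.
    by case: x2 => h12 _ _ _; apply: leq_trans h12.
  exact: splits_extends x2 x1 sp1.
pose c := nat_rect (fun=> stage) c0 (fun k c => next (k, c)).
have vc k : valid (c k).
  by elim: k => //= k IHk; case: (nextP (k, c k) IHk).
exists c; split=> // [k|P prP Pc [e dec]].
  by case: (nextP (k, c k) (vc k)).
have [k Ek] := Esurj e; have [_ _ /(_ P prP (Pc k.+1))] := nextP (k, c k) (vc k).
by rewrite /= Ek.
Qed.

(** The integer representing the initial segment of [Y] of length [n]. *)
Definition node (Y : nat -> bool) (n : nat) : nat := (string_code (mkseq Y n)).+1.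

Lemma nodeS Y n : node Y n.+1 = (node Y n).*2 + Y n.
Proof.
by rewrite /node mkseqS /string_code foldl_rcons; case: (Y n) => /=; lia.
Qed.

Lemma node_divn Y n d : node Y (n + d) %/ 2 ^ d = node Y n.
Proof.
elim: d => [|d IHd]; first by rewrite addn0 divn1.
by rewrite addnS nodeS expnS divnMA divn2 addnC half_bit_double.
Qed.

Lemma node_level Y n : node Y n %/ 2 ^ n = 1.
Proof. exact: (node_divn Y 0 n). Qed.

Lemma node_prefix Y Z n i : node Y n = node Z n -> i < n -> Y i = Z i.
Proof.
move=> YZ ilt; have : node Y i.+1 = node Z i.+1.
  by rewrite -(node_divn Y _ (n - i.+1)) -(node_divn Z _ (n - i.+1)) subnKC // YZ.
move/(congr1 odd); rewrite !nodeS !oddD !odd_double /=.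
by rewrite !oddb.
Qed.

Lemma eq_node Y Z n : (forall i, i < n -> Z i = Y i) -> node Z n = node Y n.
Proof.
move=> ZY; congr (string_code _).+1; apply/eq_in_map => i.
by rewrite mem_iota => /andP[_]; apply: ZY.
Qed.

Lemma branch_exists (z : nat -> nat) : z 0 = 1 -> (forall n, (z n.+1)./2 = z n) ->
  exists Y, forall n, node Y n = z n.
Proof.
move=> z0 zS; exists (fun n => odd (z n.+1)); elim=> [|n IHn] //.
by rewrite nodeS IHn -zS addnC odd_double_half.
Qed.

(** Nodes on increasing levels, each extending the previous one, determine a
branch: for [n <= H n], the prefix of length [n] can be read off [f n]. *)
Lemma branch_through (f H : nat -> nat) :
  (forall i, H i < H i.+1) -> f 0 %/ 2 ^ H 0 = 1 ->
  (forall i, f i.+1 %/ 2 ^ (H i.+1 - H i) = f i) ->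
  exists Y, forall i, node Y (H i) = f i.
Proof.
move=> Hlt f0 fS.
have Hd i d : H i + d <= H (i + d).
  elim: d => [|d IHd]; first by rewrite !addn0.
  by rewrite !addnS; apply: leq_ltn_trans IHd (Hlt _).
have Hge i : i <= H i by have := Hd 0 i; rewrite add0n; clear; lia.
have fd i d : f (i + d) %/ 2 ^ (H (i + d) - H i) = f i.
  elim: d => [|d IHd]; first by rewrite addn0 subnn divn1.
  rewrite addnS; have -> : H (i + d).+1 - H i =
      (H (i + d).+1 - H (i + d)) + (H (i + d) - H i).
    by have := Hd i d; have := Hlt (i + d); clear; lia.
  by rewrite divn_exp2D fS.
have [||Y YE] := @branch_exists (fun n => f n %/ 2 ^ (H n - n)).
- by rewrite subn0.
- move=> n; rewrite -divn_exp2S.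
  have -> : (H n.+1 - n.+1).+1 = (H n.+1 - H n) + (H n - n).
    by have := Hlt n; have := Hge n; clear; lia.
  by rewrite divn_exp2D fS.
- exists Y => i; rewrite YE.
  by have := fd i (H i - i); rewrite subnKC.
Qed.

Section Fusion.
Variable c : nat -> stage.
Hypotheses (validc : forall k, valid (c k))
  (extc : forall k, extends (c k.+1) (c k))
  (heightc : forall k, height (c k) < height (c k.+1)).

Lemma height_add k d : height (c k) + d <= height (c (k + d)).
Proof.
elim: d => [|d IHd]; first by rewrite !addn0.
by rewrite !addnS; apply: leq_ltn_trans IHd (heightc _).
Qed.

Lemma extends_leq j k : j <= k -> extends (c k) (c j).
Proof.
move=> /subnKC <-; elim: (k - j) => [|d IHd].
  by rewrite addn0; apply: extends_refl.
by rewrite addnS; apply: extends_trans IHd.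
Qed.

Lemma height_inj j k : height (c j) <= height (c k) -> j <= k.
Proof.
move=> jk; rewrite leqNgt; apply/negP => kj.
have := height_add k (j - k); rewrite (subnKC (ltnW kj)).
by move: jk kj; clear; lia.
Qed.

Definition fusion : set cantor_space :=
  [set Y | forall k, node Y (height (c k)) \in nodes (c k)]%classic.

(** By [fusion_codes] this is the tree of initial segments of [fusion]. *)
Definition fusion_tree (m : nat) : bool :=
  `[< exists k s l, [/\ s \in nodes (c k), m = s %/ 2 ^ l & 0 < m] >].

Lemma fusion_tree_pruned : pruned fusion_tree.
Proof.
split=> [m l /asboolP[k [s [i [sc -> _]]]] m0|m d /asboolP[k [s [l [sc mE m0]]]]].
  by apply/asboolP; exists k, s, (i + l); rewrite divn_exp2D.
have [_ _ _ /(_ s sc)[s' s'c s's]] := extends_leq (leq_addr d k).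
have hd : d <= height (c (k + d)) - height (c k).
  by have := height_add k d; clear; lia.
set h := height _ - _ in s's hd.
have m'm : s' %/ 2 ^ (h + l - d) %/ 2 ^ d = m.
  rewrite -divn_exp2D mE -s's -divn_exp2D subnK //.
  by apply: leq_trans hd (leq_addr _ _).
exists (s' %/ 2 ^ (h + l - d)) => //; apply/asboolP.
exists (k + d), s', (h + l - d); split=> //.
by rewrite lt0n; apply: contraTneq m0 => m'0; rewrite -m'm m'0 div0n.
Qed.

Lemma nodes_level k s : s \in nodes (c k) -> s %/ 2 ^ height (c k) = 1.
Proof. by move=> sc; have [_ lev _ _] := validc k; apply: lev. Qed.

(** Two nodes of different stages on the same branch are on the levels of their
stages, so a prefix on level [height (c k)] is a node of stage [k].  Every
prefix is in the body of stage [k], because it has an extension among the nodes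
of a later stage, and these are fat in the later and smaller body. *)
Lemma fusion_tree_passes k : passes fusion_tree (c k).
Proof.
split=> [s sk|m /asboolP[j [s [l [sc -> _]]]]].
  apply/asboolP/idP => [[j [s' [l [s'c sE _]]]]|sc]; last first.
    exists k, s, 0; rewrite divn1; split=> //.
    by rewrite lt0n; apply/eqP => s0; rewrite s0 div0n in sk.
  have hE : l + height (c k) = height (c j).
    apply: (@level_uniq s'); last exact: nodes_level.
    by rewrite divn_exp2D -sE.
  have jk : k <= j by apply: height_inj; rewrite -hE leq_addl.
  have [_ _ /(_ _ s'c) sub _] := extends_leq jk.
  by rewrite sE; move: sub; rewrite -hE addnK.
have [_ _ _ /(_ s sc)[s' s'c <-]] := extends_leq (leq_maxl j k).
rewrite -divn_exp2D; have [_ _ treeB _] := validc k; apply: tree_divn => //.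
have [_ subB _ _] := extends_leq (leq_maxr j k); apply: subB.
by have [_ _ tB fB] := validc (maxn j k); apply: fat_in (fB _ s'c).
Qed.

Lemma fusion_branch k s : s \in nodes (c k) ->
  exists2 Y, fusion Y & node Y (height (c k)) = s.
Proof.
move=> sc.
have /choice[next nextP] (p : nat * nat) : exists s', p.2 \in nodes (c p.1) ->
    s' \in nodes (c p.1.+1) /\
    s' %/ 2 ^ (height (c p.1.+1) - height (c p.1)) = p.2.
  case: p => i r /=; case: (boolP (r \in nodes (c i))) => [rc|_]; last by exists 0.
  by have [_ _ _ /(_ r rc)[s' s'c s'r]] := extc i; exists s'.
pose f i := nat_rect (fun=> nat) s (fun i r => next (k + i, r)) i.
have fc i : f i \in nodes (c (k + i)).
  elim: i => [|i IHi]; first by rewrite addn0.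
  by rewrite addnS; case: (nextP (k + i, f i) IHi).
have fS i : f i.+1 %/ 2 ^ (height (c (k + i.+1)) - height (c (k + i))) = f i.
  by rewrite addnS; case: (nextP (k + i, f i) (fc i)).
have [||i|Y YE] := @branch_through f (fun i => height (c (k + i))).
- by move=> i; rewrite addnS.
- by rewrite addn0 nodes_level.
- by rewrite addnS; case: (nextP (k + i, f i) (fc i)).
exists Y; last by have := YE 0; rewrite addn0.
move=> j; have jk : j <= k + j := leq_addl k j.
have [hjk _ sub _] := extends_leq jk.
have := sub (f j) (fc j); rewrite -YE.
by rewrite -{1}(subnKC hjk) node_divn.
Qed.

Lemma fusion_codes : string_set_code (prefix_tree fusion) = codes fusion_tree.
Proof.
apply/seteqP; split=> [_ [s [Y FY sY] <-]|a /asboolP[k [s [l [sc aE _]]]]].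
  rewrite /codes /=; have hs := height_add 0 (size s).
  have {}hs : size s <= height (c (size s)) by move: hs; clear; rewrite add0n; lia.
  apply/asboolP; exists (size s), (node Y (height (c (size s)))).
  exists (height (c (size s)) - size s); split=> //.
  by rewrite -{1}(subnKC hs) node_divn {1}sY.
have [Y FY Ys] := fusion_branch sc.
have lk : l <= height (c k).
  rewrite leqNgt; apply/negP => kl; move: aE.
  rewrite -(subnKC (ltnW kl)) divn_exp2D nodes_level // divn_small //.
  by rewrite -{1}[1]/(2 ^ 0) ltn_exp2l // subn_gt0.
exists (mkseq Y (height (c k) - l)).
  by exists Y => //; rewrite /initial_segment size_mkseq.
apply: succn_inj; rewrite aE -Ys -{2}(subnK lk) node_divn //.
Qed.

Lemma fusion_nonempty : (fusion !=set0)%classic.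
Proof.
have [[s sc] _ _ _] := validc 0.
by have [Y FY _] := fusion_branch sc; exists Y.
Qed.

Lemma cylinder_nbhs (Y : cantor_space) n :
  nbhs Y [set Z : cantor_space | forall i, i < n -> Z i = Y i]%classic.
Proof.
elim: n => [|n IHn]; first by apply: filterS filterT => Z _ i.
have Yn : nbhs Y [set Z : cantor_space | Z n = Y n]%classic.
  have := @proj_continuous nat (fun=> bool) n Y [set Y n]%classic.
  by apply; apply: open_nbhs_nbhs; split=> //; apply: discrete_open.
apply: filterS2 IHn Yn => Z ZY Zn i.
by rewrite ltnS leq_eqVlt => /predU1P[->|/ZY].
Qed.

(** A point is the limit of points that branch off from it at one stage after
the other. *)
Lemma fusion_perfect : (forall k, splits (c k.+1) (c k)) -> perfect_set fusion.
Proof.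
move=> splitc; have hge n : n <= height (c n).
  by have := height_add 0 n; rewrite add0n; clear; lia.
split.
  move=> Y clY k; have [Z [FZ ZY]] := clY _ (cylinder_nbhs Y (height (c k))).
  by rewrite -(eq_node ZY).
apply/seteqP; split=> [Y limY k|Y FY U UY].
  have [Z [_ FZ ZY]] := limY _ (cylinder_nbhs Y (height (c k))).
  by rewrite -(eq_node ZY).
have /choice[Z ZP] n : exists Z, [/\ Z != Y, fusion Z &
    forall i, i < n -> Z i = Y i].
  have [s1 [s2 [s12 s1c s2c [s1Y s2Y]]]] := splitc n _ (FY n).
  have [s [sY sc sn]] : exists s, [/\ s != node Y (height (c n.+1)),
      s \in nodes (c n.+1) &
      s %/ 2 ^ (height (c n.+1) - height (c n)) = node Y (height (c n))].
    case: (eqVneq s1 (node Y (height (c n.+1)))) s12 => [-> s12|? _].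
      by exists s2; rewrite eq_sym.
    by exists s1.
  have [Z FZ Zs] := fusion_branch sc; exists Z; split=> //.
    by apply: contraNneq sY => <-; rewrite Zs.
  move=> i iltn; apply: (@node_prefix _ _ (height (c n))).
    by rewrite -sn -Zs -{1}(subnKC (ltnW (heightc n))) node_divn.
  exact: leq_trans (hge n).
have ZY : ((Z n : cantor_space) @[n --> \oo] --> Y)%classic.
  apply/(@pointwise_cvgP nat bool) => i.
  apply/discrete_cvg; exists i.+1 => // n /= ilt.
  by have [_ _ ->] := ZP n.
have [n _ /(_ n (leqnn n)) UZ] := ZY U UY.
by have [nY FZ _] := ZP n; exists (Z n).
Qed.
End Fusion.

(** * Sets of positive measure contain the branches of a fat tree *)

Lemma exp2V_small (R : realType) (e : R) : (0 < e)%R -> exists k, (2 ^- k <= e)%R.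
Proof.
move=> e0; exists (Num.bound e^-1); set k := Num.bound _.
rewrite -[leRHS]invrK lef_pV2 ?posrE ?invr_gt0 ?exprn_gt0 //.
apply: le_trans (ltW (archi_boundP _)) _; first by rewrite invr_ge0 ltW.
by rewrite -/k -natrX ler_nat ltnW // ltn_expl.
Qed.

Lemma uniform_outer_setT (R : realType) : (uniform_outer R setT <= 1)%E.
Proof.
apply/lee_addgt0Pr => _ /posnumP[e]; have [k ke] := exp2V_small (gt0 e).
(* The empty string, whose cylinder is everything, followed by strings of
   total measure [2 ^ - k]. *)
pose s n := nseq (if n is m.+1 then m.+1 + k else 0) false.
have cover : ([set: cantor_space] `<=` \bigcup_n cylinder (s n))%classic.
  by move=> Y _; exists 0.
apply: le_trans (ereal_inf_lbound (ex_intro2 _ _ s cover erefl)) _.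
apply: lime_le.
  by apply: is_cvg_nneseries => n _ _; rewrite lee_fin invr_ge0 exprn_ge0.
apply: nearW => n; rewrite sumEFin -EFinD lee_fin.
apply: (@le_trans _ _ (1 + 2 ^- k)%R); last by rewrite lerD2l.
have sumE m : (\sum_(0 <= i < m.+1) 2 ^- size (s i) = 1 + 2 ^- k - 2 ^- (m + k) :> R)%R.
  elim: m => [|m IHm]; first by rewrite big_nat1 /= expr0 invr1 addrK.
  rewrite big_nat_recr //= IHm size_nseq addSn exprS invfM.
  have : (2 != 0 :> R)%R by [].
  by move=> ?; field; rewrite ?expf_neq0.
case: n => [|n]; first by rewrite big_geq // addr_ge0 ?invr_ge0 ?exprn_ge0.
by rewrite sumE lerBlDr lerDl invr_ge0 exprn_ge0.
Qed.

(** Measurability is applied to the whole space only: it bounds the outer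
measure of the complement of [A] by 1 minus that of [A]. *)
Lemma complement_cover (R : realType) (A : set cantor_space) :
  has_positive_measure R A -> exists (s : nat -> seq bool) (k : nat),
    (~` A `<=` \bigcup_n cylinder (s n))%classic /\
    forall N, (\sum_(0 <= n < N) 2 ^- size (s n) <= 1 - 2 ^- k :> R)%R.
Proof.
move=> [carA posA].
have : (uniform_outer R (~` A)%classic < 1)%E.
  have := carA setT; rewrite !setTI => TE.
  rewrite ltNge; apply/negP => ge1.
  have := uniform_outer_setT R; rewrite TE leNgt => /negP; apply.
  apply: lt_le_trans (leeD2l _ ge1).
  by rewrite -[ltLHS]add0e lteD2rE.
move=> /ereal_inf_lt[_ [s cover <-] sum_lt1].
have u0 n : (0 <= (2 ^- size (s n))%:E :> \bar R)%E.
  by rewrite lee_fin invr_ge0 exprn_ge0.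
have sum_le N := nneseries_lim_ge N (fun n (_ : 0 <= n) (_ : true) => u0 n).
set S := (\sum_(n <oo) _)%E in sum_lt1 sum_le.
have Sfin : S \is a fin_num.
  rewrite ge0_fin_numE; first exact: lt_trans (ltry 1).
  by have := sum_le 0; rewrite big_geq.
have [k kS] : exists k, (2 ^- k <= 1 - fine S)%R.
  by apply: exp2V_small; rewrite subr_gt0 -lte_fin fineK.
exists s, k; split=> // N; have := sum_le N.
rewrite sumEFin -(fineK Sfin) lee_fin => /le_trans; apply.
by rewrite lerBrDl addrC -lerBrDl.
Qed.

Lemma string_level s : (string_code s).+1 %/ 2 ^ size s = 1.
Proof. by have := node_level (nth false s) (size s); rewrite /node mkseq_nth. Qed.

Lemma population_point s0 s a : population (fun m => m == s0) s a <= 1.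
Proof.
elim: a s => [|a IHa] s /=; first by case: eqP.
case: (posnP (population (fun m => m == s0) s.*2 a)) => [->|].
  exact: IHa.
move=> /wsum_gt0[m /eqP -> ms].
case: (posnP (population (fun m => m == s0) s.*2.+1 a)) => [->|].
  by rewrite addn0.
by move=> /wsum_gt0[m' /eqP -> ms']; move: ms'; rewrite ms; lia.
Qed.

(** At depth [d], the strings extending [s] make up a proportion of at most
[2 ^ - |s|] of all strings. *)
Lemma population_cylinder (s : seq bool) d :
  population (fun m => `[< exists l, m %/ 2 ^ l = (string_code s).+1 >]) 1 d *
    2 ^ size s <= 2 ^ d.
Proof.
set E := fun m : nat => _.
have lE m l : m %/ 2 ^ d = 1 -> m %/ 2 ^ l = (string_code s).+1 -> l + size s = d.
  move=> md ml; apply: (@level_uniq m) => //.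
  by rewrite divn_exp2D ml string_level.
case: (leqP (size s) d) => [sd|ds]; last first.
  rewrite (@wsum_eq _ (fun=> 0 * 1)) ?wsumZ // => m md.
  by rewrite /E asboolF // => -[l /(lE _ _ md)]; lia.
rewrite -{1}(subnKC sd) wsum_split -{2}(subnK sd) expnD leq_mul2r orbC.
apply/orP; left; rewrite -[leqRHS]muln1.
apply: leq_trans (leq_mul (leqnn _) (population_point (string_code s).+1 1 (size s))).
rewrite -wsumZ; apply: wsum_le => m m1.
case: eqP => [_|ms]; first by rewrite muln1 population_le.
rewrite muln0 leqn0; apply/negP => /negP; rewrite -lt0n.
move=> /wsum_gt0[m' /asboolP[l m'l] m'm].
have ld : l + size s = d by apply: lE m'l; rewrite -(subnK sd) divn_exp2D m'm.
by apply: ms; rewrite -m'm -m'l; congr (m' %/ 2 ^ _); move: ld; clear; lia.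
Qed.

(** The strings extending no string of the cover form a tree of measure at least
[2 ^ - k].  At each depth only finitely many strings of the cover are relevant,
so finite partial sums suffice. *)
Lemma positive_measure_tree (R : realType) (A : set cantor_space) :
  has_positive_measure R A -> exists T : nat -> bool,
    [/\ tree T, fat T 1 & forall Y, (forall n, T (node Y n)) -> A Y].
Proof.
move=> /complement_cover[s [k [cover sum_le]]].
pose E n m := `[< exists l, m %/ 2 ^ l = (string_code (s n)).+1 >].
pose T m := ~~ `[< exists n, E n m >].
exists T; split.
- move=> m; apply: contraNN => /asboolP[n /asboolP[l ml]].
  by apply/asboolP; exists n; apply/asboolP; exists l.+1; rewrite expnS divnMA divn2.
- exists k => d.
  have [||N NP] := @uniform_bound
    (fun m h => ~~ T m -> exists2 n, n < h & E n m) (2 ^ d.+1).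
  + by move=> m h h' hh' Ph /Ph[n nh En]; exists n => //; apply: leq_trans hh'.
  + move=> m _; case Tm: (T m); first by exists 0.
    by move/negbFE: Tm => /asboolP[n En]; exists n.+1 => _; exists n.
  have TN : population (fun m => ~~ T m) 1 d <= \sum_(0 <= n < N) population (E n) 1 d.
    apply: (@leq_trans (wsum (fun m => \sum_(0 <= n < N) E n m) 1 d)).
      apply: wsum_le => m md; case nT: (~~ T m) => //.
      have [|n nN En] := NP m _ nT.
        by rewrite expnS -ltn_divLR ?expn_gt0 // md.
      by rewrite (bigD1_seq n) ?iota_uniq ?mem_index_iota //= En.
    rewrite leq_eqVlt; apply/orP; left; apply/eqP.
    elim: (N) => [|M IHM].
      rewrite big_geq // -[RHS](wsumZ 0 (fun=> 0) 1 d).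
      by apply: wsum_eq => m _; rewrite big_geq.
    rewrite big_nat_recr //= -IHM -wsumD.
    by apply: wsum_eq => m _; rewrite big_nat_recr.
  have Tsum : population T 1 d + population (fun m => ~~ T m) 1 d = 2 ^ d.
    by rewrite -wsumD -(wsum1 1 d); apply: wsum_eq => m _; case: (T m).
  have nTle : ((population (fun m => ~~ T m) 1 d)%:R <= 2 ^+ d * (1 - 2 ^- k) :> R)%R.
    apply: (@le_trans _ _ (\sum_(0 <= n < N) (2 ^+ d * 2 ^- size (s n)))%R).
      apply: (@le_trans _ _ (\sum_(0 <= n < N) population (E n) 1 d)%:R%R).
        by rewrite ler_nat.
      rewrite natr_sum; apply: ler_sum => n _.
      rewrite ler_pdivlMr ?exprn_gt0 // -!natrX -natrM ler_nat.
      exact: population_cylinder.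
    by rewrite -mulr_sumr ler_wpM2l ?exprn_ge0.
  rewrite -(ler_nat R) natrM !natrX -ler_pdivrMl ?exprn_gt0 //.
  move/(congr1 (fun n => n%:R%R : R)): Tsum; rewrite natrD natrX.
  lra.
- move=> Y YT; apply: contrapT => /cover[n _ Yn].
  have /asboolP := YT (size (s n)); apply; exists n; apply/asboolP; exists 0.
  by rewrite divn1 /node -Yn.
Qed.

(** * Sets of positive measure have perfect subsets that avoid a cone *)

Theorem corollary2p9 (R : realType) (X : set nat) (A : set cantor_space) :
  ~ computable X ->
  has_positive_measure R A ->
  exists C : set cantor_space,
    perfect_subset C A /\ ~ (X <=_T string_set_code (prefix_tree C)).
Proof.
move=> nX /positive_measure_tree[T [treeT fatT TA]].
have v0 : valid (Stage 0 [:: 1] T).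
  by split=> //= [|s|s]; [exists 1|rewrite inE => /eqP ->|rewrite inE => /eqP ->].
have [c [c0 vc stepc avoid]] := fusion_sequence nX v0.
have extc k : extends (c k.+1) (c k) by case: (stepc k).
have heightc k : height (c k) < height (c k.+1) by case: (stepc k).
have splitc k : splits (c k.+1) (c k) by case: (stepc k).
have passc k := fusion_tree_passes vc extc heightc k.
exists (fusion c); split; last first.
  rewrite fusion_codes //.
  by apply: avoid passc; apply: fusion_tree_pruned.
split; [exact: fusion_nonempty|exact: fusion_perfect|].
move=> Y FY; apply: TA => n.
have [_] := passc 0; rewrite c0 /=; apply; apply/asboolP.
have nh : n <= height (c n).
  by have := height_add heightc 0 n; rewrite add0n; clear; lia.
exists n, (node Y (height (c n))), (height (c n) - n); split=> //.
by rewrite -{1}(subnKC nh) node_divn.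
Qed.
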